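(* There exists a constant $c_0>0$ such that the following holds. Let $q:\mathbb Z^2\to[0,\infty)$ satisfy $q(o)>0$, $q(x_1,x_2)=q(-x_1,x_2)$ for all $(x_1,x_2)\in\mathbb Z^2$, and $q(x)\le c_3|x|^{-\beta}$ for all $x\in\mathbb Z^2\setminus\{o\}$, for some $c_3>0$ and some $\beta>2$ with $\beta\ge c_0+\frac32$. Let $g$ be the centered Gaussian field on $\mathbb Z^2$ with covariance given by the convolution $q*q(x-y)$ (as constructed in the context), and let $f(x)=\mathbf 1_{\{g_x>0\}}-\mathbf 1_{\{g_x<0\}}$. Then there exist $c_2,\xi>0$ such that, if $\delta\le c_2$, the random walk $(X_n)_{n\in\mathbb N}$ on the environment $f$ with parameter $\delta\in[0,1/2]$ satisfies $$\inf_{n\ge1}\mathbb P\big(|X_n|\ge n^\xi\big)>0.$$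
   Context: $o$ is the origin of $\mathbb Z^2$. The Gaussian field is $g_x=\sum_{y\in\mathbb Z^2}q(x-y)W_y$, with $(W_y)_{y\in\mathbb Z^2}$ i.i.d. standard normal random variables, so that $\mathrm{Cov}(g_x,g_y)=\sum_{z}q(x-z)q(y-z)$. The random walk: given a realization of the environment $f$ and $\delta\in[0,1/2]$, $X_0=0$ and $(X_n)_{n\ge0}$ is the Markov process on $\mathbb Z$ with $\mathbb P^f(X_{n+1}=x+1\mid X_n=x)=1-\mathbb P^f(X_{n+1}=x-1\mid X_n=x)=\frac12+\delta\big(\mathbf 1_{\{f(x,n)>0\}}-\mathbf 1_{\{f(x,n)<0\}}\big)$. $\mathbb P$ is the annealed law (averaged over $f$). *)

(* Defs.v *)
From mathcomp Require Import all_boot all_order all_algebra.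
From mathcomp Require Import all_classical all_reals all_analysis.
Import Order.TTheory GRing.Theory Num.Theory numFieldNormedType.Exports.

Set Implicit Arguments.
Unset Strict Implicit.
Unset Printing Implicit Defensive.

Local Open Scope classical_set_scope.
Local Open Scope ring_scope.

Definition euclid_norm (R : realType) (x : int * int) : R :=
  Num.sqrt (x.1%:~R ^+ 2 + x.2%:~R ^+ 2).

Definition mutually_independent (d : measure_display) (T : measurableType d)
    (R : realType) (P : probability T R) (I : choiceType)
    (W : I -> {RV P >-> R}) : Prop :=
  forall (s : seq I) (A : I -> set R),
    uniq s -> (forall i, measurable (A i)) ->
    (P (\bigcap_(i in [set` s]) (W i @^-1` A i)) =
     \prod_(i <- s) P (W i @^-1` A i))%E.

Definition iid_standard_normal (d : measure_display) (T : measurableType d)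
    (R : realType) (P : probability T R) (I : choiceType)
    (W : I -> {RV P >-> R}) : Prop :=
  mutually_independent W /\
  (forall (i : I) (A : set R), measurable A ->
     distribution P (W i) A = normal_prob 0 1 A).

Definition box (N : nat) : set (int * int) :=
  [set y | `|y.1| <= N%:Z /\ `|y.2| <= N%:Z].

(* The series \sum_(y in Z^2) q (x - y) * w y for one realization w of the
   noise. When q is summable it converges absolutely for almost every
   realization of an i.i.d. standard normal noise, so summing along boxes is
   immaterial; on the remaining null set [limn] returns a default value. The
   resulting field is centered Gaussian with covariance
   \sum_z q (x - z) * q (y - z). *)
Definition noise_convolution (R : realType) (q : int * int -> R)
    (w : int * int -> R) (x : int * int) : R :=
  limn (fun N : nat => \sum_(y \in box N) q (x - y) * w y).

Definition sign_environment (R : realType) (g : int * int -> R)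
    (x : int * int) : R :=
  (0 < g x)%R%:R - (g x < 0)%R%:R.

(* Sites are pairs (position, time). *)
Definition step_prob (R : realType) (f : int * int -> R) (delta : R)
    (n : nat) (x y : int) : R :=
  let p := 1 / 2 + delta * ((0 < f (x, n%:Z))%R%:R - (f (x, n%:Z) < 0)%R%:R) in
  if y == x + 1 then p else if y == x - 1 then 1 - p else 0.

(* (X_n) is a (time-inhomogeneous) Markov process on Z started at x0, with
   transition probabilities p n x y from x at time n to y at time n + 1; the
   Markov property is written multiplicatively, so that it says nothing when
   the conditioning event is null. *)
Definition markov_process (d : measure_display) (T : measurableType d)
    (R : realType) (mu : {measure set T -> \bar R}) (X : nat -> T -> int)
    (x0 : int) (p : nat -> int -> int -> R) : Prop :=
  [/\ forall n k, measurable [set t | X n t = k],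
      mu [set t | X 0%N t = x0] = 1%E
    & forall (n : nat) (x : nat -> int) (y : int),
        let past := [set t | forall i, (i <= n)%N -> X i t = x i] in
        (mu (past `&` [set t | X n.+1 t = y]) =
         mu past * (p n (x n) y)%:E)%E].

(* A random walk in the random environment f, a function of the sample point
   w: under the quenched law Pf w, (X_n) is the Markov process on Z started
   at 0 whose transitions are given by the realization f w. *)
Definition random_walk (d d' : measure_display) (T : measurableType d)
    (T' : measurableType d') (R : realType) (f : T -> int * int -> R)
    (delta : R) (Pf : R.-pker T ~> T') (X : nat -> T' -> int) : Prop :=
  forall w : T, markov_process (Pf w) X 0 (step_prob (f w) delta).

Definition annealed (d d' : measure_display) (T : measurableType d)
    (T' : measurableType d') (R : realType) (P : probability T R)
    (Pf : R.-pker T ~> T') (B : set T') : \bar R :=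
  (\int[P]_w Pf w B)%E.

(* Main.v *)
From HB Require Import structures.
Require Import Defs.
From mathcomp Require Import all_boot all_order all_algebra.
From mathcomp Require Import all_classical all_reals all_analysis.
From mathcomp Require Import measurable_realfun zify ring lra.
Import Order.TTheory GRing.Theory Num.Theory numFieldNormedType.Exports.
Set Implicit Arguments.
Unset Strict Implicit.
Unset Printing Implicit Defensive.
Local Open Scope classical_set_scope.
Local Open Scope ring_scope.

(** The walk cannot stay within a bounded or slowly growing window because its
    displacements over well separated time blocks are almost independent and
    symmetric.  Spreading is measured by
      [phi_n(th) = E cos (th X_n)],
    the characteristic function of [X_n]; being at most 1/2 in absolute value at
    [th] forces [|X_n|] to exceed a constant multiple of [1/th] with probability
    bounded below ([ball_lower]).

    Decoupling.  If [q] is cut off at distance [r], environments at times that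
    differ by more than [2r] are independent.  What happens in the gap of length
    [g] between two blocks is correlated with both, and two walks started from
    nearby points of the same environment may separate, so the gap cannot simply
    be neglected.  But the quenched expectation of a nondecreasing function is
    nondecreasing in the starting point (nearest-neighbour paths of the same
    parity cannot jump over each other), and both [th * id + cos (th .)] and
    [th * id - cos (th .)] are nondecreasing.  Hence moving the starting point of
    the second block by at most [g] changes the quenched [cos] expectation by at
    most [th] times the difference of the quenched mean end points of two walks
    started [2g] apart ([walk_exp_gap]); by translation invariance this difference
    has annealed mean exactly [2g].  Together with the reflection symmetry of [q]
    and of the normal law, which kills the [sin] part, this gives
      [|phi_(n+g+m)(th)| <= |phi_n(th)| |phi_m(th)| + 2 g th]  ([charf_merge]).

    Truncation.  The tail of the noise series beyond distance [r] is of order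
    [r^-30] outside an event of probability of order [r^-28], and the truncated
    field is rarely that close to zero; so the signs of the field and of its
    truncation agree on the whole space-time cone of [n] steps up to probability
    of order [n^2 r^-28] ([sign_stable_cone]).  With [r] close to [n^(1/8)] this is
    negligible: the freedom to choose a large [c0] is used here.

    Induction on scales.  From [cos 2a = 2 cos^2 a - 1], [phi_n(th) <= 1/2] implies
    [phi_n(th/2)^2 <= 3/4], and three merges bring this back below 1/2 at time
    about [8n].  So the frequency is halved each time [n] is multiplied by at most
    16, and [th <= n^(-1/4)] is preserved ([spread_step]).  The induction is started
    on a fixed range of times by taking [delta] so small that the walk is there
    close to the simple random walk, whose characteristic function is [cos^n th]
    ([spread_base]).  The distance [1/th >= n^(1/4)] beats both the gap length
    and the required window [n^(1/8)], so the theorem follows for large [n]; for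
    small [n] it is enough that the walk may take all its steps to the right. *)

(** * Quenched expectations of nearest-neighbour walks *)

Section quenched_expectation.
Variable R : realType.
Implicit Types (p : nat -> int -> R) (h : int -> R).

(** Backward equation for the expectation of [h] at the position reached after [n]
    steps from site [x] at time [k], where [p j y] is the probability of a step to
    the right.  Only finitely many values of [p] enter, which makes measurability
    and independence questions about the environment finite ones. *)
Fixpoint walk_exp p (n k : nat) h (x : int) : R :=
  if n is m.+1 then
    p k x * walk_exp p m k.+1 h (x + 1) + (1 - p k x) * walk_exp p m k.+1 h (x - 1)
  else h x.

Definition is_prob p := forall k x, 0 <= p k x <= 1.

(** Finite propagation speed: after [n] steps the walk has seen only a cone. *)
Lemma walk_exp_ext p p' n k h h' x :
  (forall j y, (k <= j < k + n)%N -> (`|y - x| <= n)%N -> p j y = p' j y) ->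
  (forall y, (`|y - x| <= n)%N -> h y = h' y) ->
  walk_exp p n k h x = walk_exp p' n k h' x.
Proof.
elim: n k x => [|n IH] k x Hp Hh /=; first by apply: Hh; lia.
rewrite Hp; [|lia|lia].
by congr (_ * _ + _ * _); apply: IH => [j y ? ?|y ?]; rewrite ?Hp ?Hh //; lia.
Qed.

Lemma walk_exp_lin p n k a b h h' x :
  walk_exp p n k (fun y => a * h y + b * h' y) x =
  a * walk_exp p n k h x + b * walk_exp p n k h' x.
Proof. by elim: n k x => [//|n IH] k x /=; rewrite !IH; ring. Qed.

Lemma walk_exp_cst p n k a x : walk_exp p n k (fun=> a) x = a.
Proof. by elim: n k x => [//|n IH] k x /=; rewrite !IH; ring. Qed.

Lemma walk_expZ p n k a h x :
  walk_exp p n k (fun y => a * h y) x = a * walk_exp p n k h x.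
Proof. by elim: n k x => [//|n IH] k x /=; rewrite !IH; ring. Qed.

(** Comparison is only needed on the sites of the right parity; [walk_exp_gap]
    depends on this refinement. *)
Lemma walk_exp_le p n k h h' x : is_prob p ->
  (forall j, (j <= n)%N -> h (x - n%:Z + (2 * j)%:Z) <= h' (x - n%:Z + (2 * j)%:Z)) ->
  walk_exp p n k h x <= walk_exp p n k h' x.
Proof.
move=> p01; elim: n k x => [|n IH] k x Hh /=.
  by have := Hh 0%N isT; rewrite muln0 subr0 addr0.
have /andP[p0 p1] := p01 k x.
apply: lerD; apply: ler_wpM2l => //; rewrite ?subr_ge0 //; apply: IH => j jn.
  have := Hh j.+1 jn; congr (h _ <= h' _); lia.
have := Hh j (leqW jn); congr (h _ <= h' _); lia.
Qed.

Lemma walk_exp_bound p n k h x (a b : R) : is_prob p ->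
  (forall y, a <= h y <= b) -> a <= walk_exp p n k h x <= b.
Proof.
move=> p01 hab; apply/andP; split.
  rewrite -[X in X <= _](walk_exp_cst p n k a x).
  by apply: walk_exp_le => // j _; have /andP[] := hab (x - n%:Z + (2 * j)%:Z).
rewrite -[X in _ <= X](walk_exp_cst p n k b x).
by apply: walk_exp_le => // j _; have /andP[] := hab (x - n%:Z + (2 * j)%:Z).
Qed.

Lemma walk_exp_comp p n m k h x :
  walk_exp p (n + m) k h x =
  walk_exp p n k (walk_exp p m (k + n) h) x.
Proof.
elim: n k x => [|n IH] k x /=; first by rewrite addn0.
by rewrite !IH addSnnS.
Qed.

Lemma walk_exp_shift p n k j h x y :
  walk_exp p n (j + k) h (y + x) =
  walk_exp (fun i z => p (i + k)%N (z + x)) n j (fun z => h (z + x)) y.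
Proof.
elim: n j y => [//|n IH] j y /=.
rewrite -addSn -!IH; congr (_ * walk_exp _ _ _ _ _ + _ * walk_exp _ _ _ _ _); lia.
Qed.

Lemma walk_exp_opp p n k h x :
  walk_exp p n k h x =
  walk_exp (fun i z => 1 - p i (- z)) n k (fun z => h (- z)) (- x).
Proof.
elim: n k x => [|n IH] k x /=; first by rewrite opprK.
have E1 : - (x + 1) = - x - 1 by lia.
have E2 : - (x - 1) = - x + 1 by lia.
by rewrite !IH opprK E1 E2 subKr addrC.
Qed.

Lemma walk_exp_dist p n k h h' e x : is_prob p ->
  (forall y, `|h y - h' y| <= e y) ->
  `|walk_exp p n k h x - walk_exp p n k h' x| <= walk_exp p n k e x.
Proof.
move=> p01 he.
have -> : walk_exp p n k h x - walk_exp p n k h' x =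
    walk_exp p n k (fun y => 1 * h y + -1 * h' y) x.
  by rewrite walk_exp_lin mul1r mulN1r.
rewrite ler_norml -[- walk_exp _ _ _ _ _]mulN1r -walk_expZ.
apply/andP; split; apply: walk_exp_le => // j _;
  by have := he (x - n%:Z + (2 * j)%:Z); rewrite ler_norml => /andP[]; lra.
Qed.

Lemma monotone_mul2 h : (forall y, h y <= h (y + 2)) ->
  forall j y, h y <= h (y + (2 * j)%:Z).
Proof.
move=> hm; elim=> [|j IH] y; first by rewrite muln0 addr0.
apply: (le_trans (IH y)); apply: (le_trans (hm _)).
by rewrite le_eqVlt; apply/orP; left; apply/eqP; congr h; lia.
Qed.

(** The values of the two expectations interlace: in the induction step both are
    averages of neighbouring terms of the increasing sequence of values at [x - 1],
    [x + 1], [x + 3], the second one over the later pair. *)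
Lemma walk_exp_monotone p n k h : is_prob p -> (forall y, h y <= h (y + 2)) ->
  forall x, walk_exp p n k h x <= walk_exp p n k h (x + 2).
Proof.
move=> p01 hm; elim: n k => [//|n IH] k x /=.
have /andP[a0 a1] := p01 k x; have /andP[b0 b1] := p01 k (x + 2).
have E1 : x - 1 + 2 = x + 1 by lia.
have E2 : x + 2 - 1 = x + 1 by lia.
have E3 : x + 1 + 2 = x + 2 + 1 by lia.
have := IH k.+1 (x - 1); rewrite E1.
have := IH k.+1 (x + 1); rewrite E3 E2.
set A := walk_exp _ _ _ _ (x - 1); set B := walk_exp _ _ _ _ (x + 1).
set C := walk_exp _ _ _ _ (x + 2 + 1) => BC AB.
apply: (@le_trans _ _ B); nra.
Qed.

(** The walk spends [g] steps in an environment about which nothing is known and is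
    then restarted at some [z] between [x - g] and [x + g].  Since [th * id + h] and
    [th * id - h] are both nondecreasing, [H z] and [H (x + g)] differ by at most [th]
    times the increment of [I], the quenched mean end point. *)
Lemma walk_exp_gap p g m k k' h th : is_prob p -> 0 <= th ->
  (forall y, `|h (y + 2) - h y| <= 2 * th) ->
  forall x, let H := walk_exp p m k' h in let I := walk_exp p m k' intr in
  `|walk_exp p g k H x - H (x + g%:Z)| <= th * (I (x + g%:Z) - I (x - g%:Z)).
Proof.
move=> p01 th0 hL x; set H := walk_exp p m k' h; set I := walk_exp p m k' intr; cbv zeta.
have mono (e : R) (he : e = 1 \/ e = -1) j y :
    th * I y + e * H y <= th * I (y + (2 * j)%:Z) + e * H (y + (2 * j)%:Z).
  rewrite -!walk_exp_lin.
  apply: (@monotone_mul2 (walk_exp p m k' (fun y => th * y%:~R + e * h y))).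
  apply: walk_exp_monotone => // z; rewrite rmorphD /=.
  have := hL z; rewrite ler_norml => /andP[]; case: he => ->; lra.
have Imono j y : I y <= I (y + (2 * j)%:Z).
  apply: monotone_mul2; apply: walk_exp_monotone => // z; rewrite rmorphD /=; lra.
rewrite -[H (x + _)](walk_exp_cst p g k _ x) ler_norml; apply/andP; split.
  rewrite lerBrDr -[X in X <= _](walk_exp_cst p g k _ x) addrC.
  apply: walk_exp_le => // j jg; rewrite walk_exp_cst.
  (* The lower bound uses the monotonicity of [th * id - h]. *)
  have E : x + g = x - g%:Z + (2 * j)%:Z + (2 * (g - j))%:Z by lia.
  have := mono (-1) (or_intror erefl) (g - j)%N (x - g%:Z + (2 * j)%:Z); rewrite -E.
  have := ler_wpM2l th0 (Imono j (x - g%:Z)); lra.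
rewrite lerBlDr -[X in _ <= X](walk_exp_cst p g k _ x).
apply: walk_exp_le => // j jg; rewrite walk_exp_cst.
(* The upper bound uses the monotonicity of [th * id + h]. *)
have E : x + g = x - g%:Z + (2 * j)%:Z + (2 * (g - j))%:Z by lia.
have := mono 1 (or_introl erefl) (g - j)%N (x - g%:Z + (2 * j)%:Z); rewrite -E.
have := ler_wpM2l th0 (Imono j (x - g%:Z)); lra.
Qed.

Lemma walk_exp_right p n k h x : is_prob p -> (forall j y, 1 / 4 <= p j y) ->
  (forall y, 0 <= h y) -> 1 <= h (x + n%:Z) -> (1 / 4) ^+ n <= walk_exp p n k h x.
Proof.
move=> p01 p4 h0; elim: n k x => [|n IH] k x /= h1.
  by rewrite expr0; rewrite addr0 in h1.
have p4' := p4 k x; have /andP[_ p1] := p01 k x.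
have : (1 / 4) ^+ n <= walk_exp p n k.+1 h (x + 1).
  by apply: IH; have -> : x + 1 + n = x + n.+1 by lia.
have : 0 <= walk_exp p n k.+1 h (x - 1).
  rewrite -[X in X <= _](walk_exp_cst p n k.+1 0 (x - 1)).
  by apply: walk_exp_le.
have : 0 <= (1 / 4 : R) ^+ n by rewrite exprn_ge0 // divr_ge0.
rewrite exprS; nra.
Qed.

(** One step of the simple random walk multiplies [cos (th .)] by [cos th]; a bias
    of size at most [d] adds an error of at most [2 d] per step. *)
Lemma walk_exp_cos p n k th x (d : R) : is_prob p ->
  (forall j y, `|p j y - 1 / 2| <= d) ->
  `|walk_exp p n k (fun y => cos (th * y%:~R)) x - cos th ^+ n * cos (th * x%:~R)|
    <= 2 * d * n%:R.
Proof.
move=> p01 pd; elim: n k x => [|n IH] k x /=.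
  by rewrite expr0 mul1r subrr normr0 mulr0.
have := IH k.+1 (x + 1); have := IH k.+1 (x - 1).
rewrite !rmorphD rmorphN /= !mulrDr mulrN mulr1 !cosD sinN cosN.
set u := walk_exp _ _ _ _ (x - 1); set v := walk_exp _ _ _ _ (x + 1).
set C := cos (th * _); set S := sin (th * _).
have cn : `|cos th ^+ n| <= 1 by rewrite normrX exprn_ile1 // cos_max.
have S1 : `|S| <= 1 := sin_max _.
have s1 : `|sin th| <= 1 := sin_max _.
have := pd k x; have /andP[] := p01 k x.
set q := p k x; set c := cos th ^+ n; set s := sin th => q0 q1 qd ub vb.
have d0 : 0 <= d by apply: le_trans qd.
have -> : q * v + (1 - q) * u - cos th ^+ n.+1 * C =
  q * (v - c * (C * cos th - S * s)) + (1 - q) * (u - c * (C * cos th - S * - s))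
  - 2 * (q - 1 / 2) * (c * S * s) by rewrite exprS -/c; field.
apply: le_trans (ler_normB _ _) _.
apply: le_trans (lerD (ler_normD _ _) (lexx _)) _.
rewrite !normrM (ger0_norm q0) (@ger0_norm _ (1 - q)) ?subr_ge0 // (@ger0_norm _ 2) //.
have css : `|c| * `|S| * `|s| <= 1.
  by rewrite mulr_ile1 // ?mulr_ge0 // mulr_ile1.
have cs0 : 0 <= `|c| * `|S| * `|s| by rewrite !mulr_ge0.
have N0 : 0 <= `|q - 1/2| by [].
have : 2 * `|q - 1 / 2| * (`|c| * `|S| * `|s|) <= 2 * d * 1.
  by apply: ler_pM => //; nra.
rewrite -natr1; nra.
Qed.

End quenched_expectation.

(** * Elementary bounds on the cosine *)

Section trigonometry.
Variable R : realType.

Lemma add_cos_homo (e : R) : `|e| <= 1 -> {homo (fun x : R => x + e * cos x) : x y / x <= y}.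
Proof.
move=> e1 x y; rewrite le_eqVlt => /orP[/eqP -> //|xy].
have D z : is_derive z (1 : R) (fun x : R => x + e * cos x) (1 + e * - sin z).
  apply: is_derive_eq.
  by rewrite ?scaler0 ?addr0 ?add0r /GRing.scale /=; ring.
have [|z _ E] := @MVT_segment R (fun x => x + e * cos x) (fun z => 1 + e * - sin z) _ _ (ltW xy) (fun z _ => D z).
  apply: derivable_within_continuous => z _.
  exact: ex_derive.
rewrite -subr_ge0 E mulr_ge0 ?subr_ge0 ?(ltW xy) //.
have := sin_max z; move: e1; rewrite !ler_norml => /andP[? ?] /andP[? ?]; nra.
Qed.

Lemma cos_lipschitz (x y : R) : `|cos x - cos y| <= `|x - y|.
Proof.
wlog xy : x y / y <= x.
  move=> H; have [/H //|/ltW /H] := leP y x.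
  by rewrite distrC (distrC y).
rewrite (@ger0_norm _ (x - y)) ?subr_ge0 // ler_norml.
have := @add_cos_homo 1 _ _ _ xy; rewrite normr1 => /(_ (lexx _)).
have := @add_cos_homo (-1) _ _ _ xy; rewrite normrN1 => /(_ (lexx _)).
by move=> *; apply/andP; split; lra.
Qed.

(** Half-angle formula, with [sin u >= u / 2] on [0, 1/2] because the derivative of
    the sine is at least 1/2 there. *)
Lemma cos_upper (x : R) : 0 <= x <= 1 -> cos x <= 1 - x ^+ 2 / 8.
Proof.
move=> /andP[x0 x1].
have Hs : x / 4 <= sin (x / 2).
  move: x0; rewrite le_eqVlt => /orP[/eqP <-|x0]; first by rewrite !mul0r sin0.
  have x20 : (0:R) <= x / 2 by lra.
  have [|z zin E] := @MVT_segment R sin cos _ _ x20 (fun z _ => is_derive_sin z).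
    by apply: continuous_subspaceT => z; exact: continuous_sin.
  move: E; rewrite sin0 !subr0 => ->.
  have : 1 / 2 <= cos z.
    have := cos_lipschitz 0 z; rewrite cos0 sub0r normrN.
    move: zin; rewrite in_itv /= => /andP[z0 z1].
    rewrite (ger0_norm z0) => /(le_trans (ler_norm _)); lra.
  nra.
have -> : cos x = 1 - 2 * sin (x / 2) ^+ 2.
  rewrite [in LHS](_ : x = (x / 2) + (x / 2)); last by lra.
  rewrite cosD; have := cos2Dsin2 (x / 2); rewrite !expr2; lra.
nra.
Qed.

End trigonometry.

(** * From the Markov property to quenched expectations *)

Lemma disjoint_measureU (d : measure_display) (T : measurableType d) (R : realType)
  (mu : {measure set T -> \bar R}) (A B : set T) : measurable A -> measurable B ->
  A `&` B = set0 -> mu (A `|` B) = (mu A + mu B)%E.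
Proof. exact: measureU. Qed.

Lemma measure_setD_eq0 (d : measure_display) (T : measurableType d) (R : realType)
  (mu : {measure set T -> \bar R}) (A B : set T) : measurable A -> measurable B ->
  B `<=` A -> (mu A < +oo)%E -> mu B = mu A -> mu (A `\` B) = 0%E.
Proof.
move=> mA mB BA finA AB; rewrite measureD // setIidr //.
by rewrite [X in (_ - X)%E]AB subee // ge0_fin_numE.
Qed.

Section quenched_law.
Context (d : measure_display) (T : measurableType d) (R : realType).
Variables (mu : {measure set T -> \bar R}) (X : nat -> T -> int)
  (p : nat -> int -> R).
Hypothesis mu1 : mu setT = 1%E.
Hypothesis XM : markov_process mu X 0
  (fun n x y => if y == x + 1 then p n x else if y == x - 1 then 1 - p n x else 0).

Let mX n k : measurable [set t | X n t = k]. Proof. by case: XM => H _ _; exact: H. Qed.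

Lemma measurable_position n (B : set int) : measurable [set t | B (X n t)].
Proof.
have -> : [set t | B (X n t)] = \bigcup_(k : int) [set t | X n t = k /\ B k].
  by apply/seteqP; split => t /=; [exists (X n t)|case=> k _ [<-]].
apply: countable_bigcupT_measurable => [|k]; first exact: countableP.
have [Bk|nBk] := pselect (B k).
  by rewrite (_ : [set t | _] = [set t | X n t = k]) //; apply/seteqP; split => t /=; tauto.
by rewrite (_ : [set t | _] = set0) //; apply/seteqP; split => t /=; tauto.
Qed.

Let past n (x : nat -> int) := [set t | forall i, (i <= n)%N -> X i t = x i].

Let mpast n x : measurable (past n x).
Proof.
have -> : past n x = \bigcap_(i in [set i | (i <= n)%N]) [set t | X i t = x i] by [].
by apply: bigcap_measurable => //; exists 0%N.
Qed.

(** The event that the past is prescribed up to time [n] splits, up to a null set,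
    into two such events at time [n + 1]: the two admissible steps already exhaust
    its mass.  This reproduces the backward recursion of [walk_exp]. *)
Lemma past_law n m (x : nat -> int) (B : set int) :
  mu (past n x `&` [set t | B (X (n + m)%N t)]) =
  (mu (past n x) * (walk_exp p m n \1_B (x n))%:E)%E.
Proof.
elim: m n x => [|m IH] n x /=.
  rewrite addn0 indicE; have [Bx|nBx] := pselect (B (x n)).
    rewrite mem_set // mule1; congr (mu _); apply/seteqP; split => t /= => [[]//|pt].
    by split=> //; rewrite pt.
  rewrite memNset // mule0; rewrite (_ : _ `&` _ = set0) ?measure0 //.
  by apply/seteqP; split => t //= [pt]; rewrite pt.
pose up y := fun i => if i == n.+1 then y else x i.
have pastS y : past n.+1 (up y) = past n x `&` [set t | X n.+1 t = y].
  apply/seteqP; split => t /=.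
    move=> pt; split; last by have := pt n.+1 (leqnn _); rewrite /up eqxx.
    by move=> i le_in; have := pt i (leqW le_in); rewrite /up; case: eqP => // E; lia.
  move=> [pt pn] i; rewrite /up leq_eqVlt; case: eqP => [-> //|_ /=].
  by rewrite ltnS; exact: pt.
have mB : measurable [set t | B (X (n + m.+1)%N t)] by exact: measurable_position.
have step y : mu (past n.+1 (up y) `&` [set t | B (X (n + m.+1)%N t)]) =
   (mu (past n x) * (if y == x n + 1 then p n (x n) else if y == x n - 1 then 1 - p n (x n) else 0)%:E
     * (walk_exp p m n.+1 \1_B y)%:E)%E.
  rewrite -addSnnS IH pastS; congr (_ * _)%E; last by rewrite /up eqxx.
  by case: XM => _ _ /(_ n x y) ->.
have fin : mu (past n x) \is a fin_num.
  rewrite ge0_fin_numE //; apply: le_lt_trans (_ : mu setT < _)%E.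
    by apply: le_measure; rewrite ?inE.
  by rewrite mu1 ltry.
pose A := past n x; pose Ap := past n.+1 (up (x n + 1)); pose Am := past n.+1 (up (x n - 1)).
have dis : Ap `&` Am = set0.
  apply/seteqP; split => t //=; rewrite /Ap /Am !pastS => -[[_ /= E] [_ /=]]; lia.
have subA : Ap `|` Am `<=` A by move=> t; rewrite /Ap /Am !pastS => -[[]|[]].
have mAp : measurable Ap := mpast _ _.
have mAm : measurable Am := mpast _ _.
have E1 : (x n - 1 == x n + 1) = false by lia.
have muAp : mu Ap = (mu A * (p n (x n))%:E)%E.
  by rewrite /Ap pastS; case: XM => _ _ ->; rewrite eqxx.
have muAm : mu Am = (mu A * (1 - p n (x n))%:E)%E.
  by rewrite /Am pastS; case: XM => _ _ ->; rewrite E1 eqxx.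
(* Steps of size different from 1 have probability zero. *)
have null : mu (A `\` (Ap `|` Am)) = 0%E.
  have mU : measurable (Ap `|` Am) by exact: measurableU.
  have finA : (mu A < +oo)%E by rewrite -ge0_fin_numE.
  have muU : mu (Ap `|` Am) = mu A.
    rewrite disjoint_measureU // muAp muAm.
    rewrite -muleDr //.
    by rewrite -EFinD addrC subrK mule1.
  by apply: measure_setD_eq0 => //; exact: mpast.
have -> : past n x `&` [set t | B (X (n + m.+1)%N t)] =
   ((Ap `|` Am) `&` [set t | B (X (n + m.+1)%N t)]) `|`
   ((A `\` (Ap `|` Am)) `&` [set t | B (X (n + m.+1)%N t)]).
  by rewrite -setIUl setDUK.
rewrite measureU0; first last.
  apply: subset_measure0 null => //; first apply: measurableI => //.
    by apply: measurableD; [exact: mpast|exact: measurableU].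
  by apply: measurableD; [exact: mpast|exact: measurableU].
  by apply: measurableI => //; apply: measurableD; [exact: mpast|exact: measurableU].
  by apply: measurableI => //; exact: measurableU.
rewrite setIUl disjoint_measureU; [|exact: measurableI|exact: measurableI|]; last first.
  by rewrite setIACA dis set0I.
rewrite !step eqxx E1 eqxx -!muleA -muleDr //.
Qed.

Lemma position_law n (B : set int) :
  mu [set t | B (X n t)] = (walk_exp p n 0 \1_B 0)%:E.
Proof.
have m0 : mu [set t | X 0%N t = 0] = 1%E by case: XM.
have E0 : past 0 (fun=> 0) = [set t | X 0%N t = 0].
  by apply/seteqP; split => t /= => [/(_ 0%N isT)//|E i]; rewrite leqn0 => /eqP ->.
have := past_law 0 n (fun=> 0) B; rewrite add0n E0 m0 mul1e => <-.
have mB : measurable [set t | B (X n t)] by exact: measurable_position.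
have null : mu (~` [set t | X 0%N t = 0]) = 0%E.
  rewrite -setTD; apply: measure_setD_eq0 => //; first by rewrite mu1 ltry.
  by rewrite m0 mu1.
rewrite -[X in mu X = _](setIT [set t | B (X n t)]) -(setUv [set t | X 0%N t = 0]) setIUr measureU0.
- by rewrite setIC.
- exact: measurableI.
- by apply: measurableI => //; exact: measurableC.
- apply: subset_measure0 null => //; [apply: measurableI => //|]; exact: measurableC.
Qed.

End quenched_law.

(** * Expectations of bounded random variables *)

Section mean.
Context (d : measure_display) (T : measurableType d) (R : realType).
Implicit Types (F G : T -> R) (P : probability T R).

Definition bounded_measurable F :=
  measurable_fun setT F /\ exists M : R, forall t, `|F t| <= M.

Definition mean P F : R := (\int[P]_t F t)%R.

Lemma bounded_measurable_cst (a : R) : bounded_measurable (fun=> a).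
Proof. by split; [exact: measurable_cst|exists `|a|]. Qed.

Lemma bounded_measurableD F G : bounded_measurable F -> bounded_measurable G ->
  bounded_measurable (fun t => F t + G t).
Proof.
move=> [mF [M HM]] [mG [N HN]]; split; first exact: measurable_funD.
by exists (M + N) => t; apply: le_trans (ler_normD _ _) (lerD _ _).
Qed.

Lemma bounded_measurableM F G : bounded_measurable F -> bounded_measurable G ->
  bounded_measurable (fun t => F t * G t).
Proof.
move=> [mF [M HM]] [mG [N HN]]; split; first exact: measurable_funM.
by exists (M * N) => t; rewrite normrM ler_pM.
Qed.

Lemma bounded_measurable_integrable P F : bounded_measurable F ->
  P.-integrable setT (EFin \o F).
Proof.
move=> [mF [M HM]]; apply: measurable_bounded_integrable => //.
  by rewrite (le_lt_trans (probability_le1 P _)) ?ltry.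
exists M; split; first exact: num_real.
by move=> N MN t _ /=; apply: le_trans (HM t) (ltW MN).
Qed.

Lemma mean_EFin P F : bounded_measurable F ->
  (mean P F)%:E = (\int[P]_t (F t)%:E)%E.
Proof.
by move=> bF; rewrite fineK //; apply: integrable_fin_num => //; exact: bounded_measurable_integrable.
Qed.

Lemma mean_cst P (a : R) : mean P (fun=> a) = a.
Proof. by rewrite /mean Rintegral_cst // [X in fine X](probability_setT P) mulr1. Qed.

Lemma meanD P F G : bounded_measurable F -> bounded_measurable G ->
  mean P (fun t => F t + G t) = mean P F + mean P G.
Proof. by move=> bF bG; rewrite /mean RintegralD //; exact: bounded_measurable_integrable. Qed.

Lemma meanZ P (a : R) F : bounded_measurable F ->
  mean P (fun t => a * F t) = a * mean P F.
Proof. by move=> bF; rewrite /mean RintegralZl //; exact: bounded_measurable_integrable. Qed.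

Lemma mean_lin P (a b : R) F G : bounded_measurable F -> bounded_measurable G ->
  mean P (fun t => a * F t + b * G t) = a * mean P F + b * mean P G.
Proof.
move=> bF bG; rewrite meanD ?meanZ //; apply: bounded_measurableM => //; exact: bounded_measurable_cst.
Qed.

Lemma mean_le P F G : bounded_measurable F -> bounded_measurable G ->
  (forall t, F t <= G t) -> mean P F <= mean P G.
Proof. by move=> bF bG FG; apply: le_Rintegral => //; exact: bounded_measurable_integrable. Qed.

Lemma mean_ext P F G : (forall t, F t = G t) -> mean P F = mean P G.
Proof. by move=> /funext ->. Qed.

Lemma mean_normr_le P F G : bounded_measurable F -> bounded_measurable G ->
  (forall t, `|F t| <= G t) -> `|mean P F| <= mean P G.
Proof.
move=> bF bG FG; rewrite ler_norml -mulN1r -meanZ //; apply/andP; split; apply: mean_le => //.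
- by apply: bounded_measurableM => //; exact: bounded_measurable_cst.
- by move=> t; have := FG t; rewrite ler_norml mulN1r => /andP[].
- by move=> t; have := FG t; rewrite ler_norml => /andP[].
Qed.

Lemma bounded_measurable_indic (A : set T) : measurable A ->
  bounded_measurable (\1_A : T -> R).
Proof.
move=> mA; split; first exact: measurable_indic.
by exists 1 => t; rewrite indicE; case: (_ \in _); rewrite ?normr1 ?normr0.
Qed.

Lemma mean_indic P (A : set T) : measurable A -> (mean P (\1_A))%:E = P A.
Proof.
move=> mA; rewrite mean_EFin; last exact: bounded_measurable_indic.
by rewrite integral_indic // setIT.
Qed.

Lemma bounded_measurable_walk_exp (p : T -> nat -> int -> R) n k (h : T -> int -> R) x :
  (forall j y, bounded_measurable (fun t => p t j y)) ->
  (forall y, bounded_measurable (h^~ y)) ->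
  bounded_measurable (fun t => walk_exp (p t) n k (h t) x).
Proof.
move=> bp bh; elim: n k x => [|n IH] k x /=; first exact: bh.
apply: bounded_measurableD; apply: bounded_measurableM => //.
apply: bounded_measurableD; first exact: bounded_measurable_cst.
apply: (eq_ind (fun t => -1 * p t k x) _ _ _ (funext (fun t => mulN1r _))).
by apply: bounded_measurableM => //; exact: bounded_measurable_cst.
Qed.

(** [walk_exp] is a finite linear combination of the values of its function argument. *)
Lemma mean_walk_exp P p n k (h : T -> int -> R) x :
  (forall y, bounded_measurable (h^~ y)) ->
  mean P (fun t => walk_exp p n k (h t) x) =
  walk_exp p n k (fun y => mean P (h^~ y)) x.
Proof.
move=> bh; elim: n k x => [//|n IH] k x /=.
rewrite -!IH mean_lin //; apply: bounded_measurable_walk_exp => // j y; exact: bounded_measurable_cst.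
Qed.

End mean.

Lemma mean_fubini (d d' : measure_display) (T : measurableType d) (T' : measurableType d')
  (R : realType) (P : probability T R) (P' : probability T' R) (F : T * T' -> R) :
  bounded_measurable F ->
  mean (P \x P')%E F = mean P (fun t => mean P' (fun t' => F (t, t'))).
Proof.
move=> bF; rewrite /mean /Rintegral; congr fine.
rewrite -integral12_prod_meas1; last exact: (bounded_measurable_integrable (P \x P')%E).
apply: eq_integral => t _; rewrite /fubini_F [RHS]mean_EFin //.
case: bF => mF [M HM]; split; last by exists M.
exact: measurableT_comp.
Qed.

(** * Gaussian noise and its law *)

Section noise.
Variables (R : realType) (I : choiceType).

(** Finite-dimensional product events.  They form a pi-system generating the
    sigma-algebra of [noise_space], so a law on [noise_space] is determined by its
    values on them. *)
Definition cylinder (s : seq I) (A : I -> set R) : set (I -> R) :=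
  [set w | forall i, i \in s -> A i (w i)].

Definition cylinders : set (set (I -> R)) :=
  [set C | exists s A, [/\ uniq s, forall i, measurable (A i) & C = cylinder s A]].

Definition noise_space := g_sigma_algebraType cylinders.

HB.instance Definition _ := Measurable.on noise_space.

Lemma cylinders_setI : setI_closed cylinders.
Proof.
move=> _ _ [s [A [us mA ->]]] [t [B [ut mB ->]]].
exists (undup (s ++ t)).
exists (fun i => (if i \in s then A i else setT) `&` (if i \in t then B i else setT)).
split; first exact: undup_uniq.
  by move=> i; apply: measurableI; case: ifP.
apply/seteqP; split => w /=.
  move=> [wA wB] i; rewrite mem_undup mem_cat => _.
  by split; case: ifP => // it; [exact: wA|exact: wB].
move=> H; split => i it; have := H i; rewrite mem_undup mem_cat it ?orbT => /(_ isT).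
  by case.
by case.
Qed.

Lemma cylinderT A : cylinder [::] A = setT.
Proof. by apply/seteqP; split. Qed.

Lemma measurable_cylinder s A : uniq s -> (forall i, measurable (A i)) ->
  measurable (cylinder s A : set noise_space).
Proof. by move=> us mA; apply: sub_sigma_algebra; exists s, A. Qed.

Lemma measurable_coordinate i : measurable_fun setT (fun w : noise_space => w i).
Proof.
move=> _ B mB; rewrite setTI.
rewrite (_ : _ @^-1` _ = cylinder [:: i] (fun=> B)); first exact: measurable_cylinder.
by apply/seteqP; split => w /= => [wB j|]; [rewrite inE => /eqP ->|apply; rewrite inE].
Qed.

Lemma measurable_to_noise (d : measure_display) (T : measurableType d) (V : I -> T -> R) :
  (forall i, measurable_fun setT (V i)) ->
  measurable_fun setT (fun t => (fun i => V i t) : noise_space).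
Proof.
move=> mV; apply: (@measurability _ _ T noise_space setT (fun t => (V^~ t : noise_space)) cylinders) => //.
move=> _ [_ [s [A [us mA ->]]] <-]; rewrite setTI.
have -> : (fun t => V^~ t) @^-1` cylinder s A = \bigcap_(i in [set` s]) (V i @^-1` A i).
  by apply/seteqP; split.
apply: fin_bigcap_measurable => // i _; rewrite -[X in measurable X]setTI; exact: mV.
Qed.

(** Stated for a family of functions rather than of bundled random variables, so that
    it applies verbatim to reindexed, reflected and resampled noises. *)
Definition gaussian_noise (d : measure_display) (T : measurableType d)
    (P : probability T R) (V : I -> T -> R) :=
  (forall i, measurable_fun setT (V i)) /\
  forall s A, uniq s -> (forall i, measurable (A i)) ->
    P [set t | cylinder s A (V^~ t)] = (\prod_(i <- s) normal_prob 0 1 (A i))%E.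

(** All the distributional symmetries used below are instances of this uniqueness
    statement, applied to two noises on possibly different spaces. *)
Lemma gaussian_noise_law (d d' : measure_display) (T : measurableType d)
    (T' : measurableType d') (P : probability T R) (P' : probability T' R) V V'
    (B : set noise_space) :
  gaussian_noise P V -> gaussian_noise P' V' -> measurable B ->
  P [set t | B (V^~ t)] = P' [set t | B (V'^~ t)].
Proof.
move=> [mV HV] [mV' HV'] mB.
pose X : {mfun T >-> noise_space} := HB.pack (fun t => (V^~ t : noise_space))
  (isMeasurableFun.Build _ _ _ _ _ (measurable_to_noise mV)).
pose X' : {mfun T' >-> noise_space} := HB.pack (fun t => (V'^~ t : noise_space))
  (isMeasurableFun.Build _ _ _ _ _ (measurable_to_noise mV')).
apply: (@measure_unique _ R noise_space cylinders (fun=> setT) _ _ _ _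
  (distribution P X) (distribution P' X')) => //.
- exact: cylinders_setI.
- by move=> _; exists [::], (fun=> setT); rewrite cylinderT.
- by apply/seteqP; split => // w _; exists 0%N.
- by move=> _ [s [A [us mA ->]]]; exact: etrans (HV s A us mA) (esym (HV' s A us mA)).
- by move=> _; rewrite (le_lt_trans (probability_le1 _ _)) ?ltry.
Qed.

Lemma mean_gaussian_noise (d d' : measure_display) (T : measurableType d)
    (T' : measurableType d') (P : probability T R) (P' : probability T' R) V V'
    (Phi : noise_space -> R) :
  gaussian_noise P V -> gaussian_noise P' V' -> bounded_measurable Phi ->
  mean P (fun t => Phi (V^~ t)) = mean P' (fun t => Phi (V'^~ t)).
Proof.
move=> nV nV' [mPhi [M HM]].
have [mV _] := nV; have [mV' _] := nV'.
pose X : {mfun T >-> noise_space} := HB.pack (fun t => (V^~ t : noise_space))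
  (isMeasurableFun.Build _ _ _ _ _ (measurable_to_noise mV)).
pose X' : {mfun T' >-> noise_space} := HB.pack (fun t => (V'^~ t : noise_space))
  (isMeasurableFun.Build _ _ _ _ _ (measurable_to_noise mV')).
rewrite /mean /Rintegral; congr fine.
have E1 := @integral_distribution _ _ T noise_space R P X (EFin \o Phi).
have E2 := @integral_distribution _ _ T' noise_space R P' X' (EFin \o Phi).
have mE : measurable_fun setT (EFin \o Phi) by exact/measurable_EFinP.
have iE : P.-integrable setT ((EFin \o Phi) \o X).
  apply: (@bounded_measurable_integrable _ _ _ P (Phi \o X)); split; last by exists M => t; exact: HM.
  exact: measurableT_comp.
have iE' : P'.-integrable setT ((EFin \o Phi) \o X').
  apply: (@bounded_measurable_integrable _ _ _ P' (Phi \o X')); split; last by exists M => t; exact: HM.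
  exact: measurableT_comp.
rewrite -[LHS](E1 mE iE) -[RHS](E2 mE iE').
apply: eq_measure_integral => A mA _; exact: (gaussian_noise_law nV nV' mA).
Qed.

(** Taking the coordinates in [S] from one copy and the others from an independent
    copy does not change the law.  With [mean_fubini] this is how independence of
    functions of disjoint blocks of coordinates is exploited. *)
Lemma gaussian_noise_resample (d : measure_display) (T : measurableType d)
    (P : probability T R) V (S : pred I) :
  gaussian_noise P V ->
  gaussian_noise (P \x P)%E (fun i t => if S i then V i t.1 else V i t.2).
Proof.
move=> [mV HV]; split.
  by move=> i; case: (S i); apply: measurableT_comp.
move=> s A us mA.
have -> : [set t | cylinder s A (fun i => if S i then V i t.1 else V i t.2)] =
  [set t | cylinder [seq i <- s | S i] A (V^~ t)] `*` [set t | cylinder [seq i <- s | ~~ S i] A (V^~ t)].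
  apply/seteqP; split => -[t1 t2] /=.
    move=> H; split => i; rewrite mem_filter => /andP[/= Si is_]; have := H i is_; rewrite ?Si //.
    by rewrite (negbTE Si).
  move=> [H1 H2] i is_; case: ifPn => Si; [apply: H1|apply: H2]; by rewrite mem_filter /= Si.
have mC s' : uniq s' -> measurable [set t | cylinder s' A (V^~ t)].
  move=> us'; have := measurable_to_noise mV; rewrite /measurable_fun => /(_ measurableT (cylinder s' A)).
  by rewrite setTI; apply; exact: measurable_cylinder.
rewrite [LHS](_ : _ = P [set t | cylinder [seq i <- s | S i] A (V^~ t)] *
  P [set t | cylinder [seq i <- s | ~~ S i] A (V^~ t)])%E; last first.
  by apply: product_measure1E; apply: mC; exact: filter_uniq.
rewrite !HV ?filter_uniq // !big_filter.
by rewrite [RHS](bigID S).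
Qed.

Lemma gaussian_noise_reindex (d : measure_display) (T : measurableType d)
    (P : probability T R) V (u v : I -> I) :
  cancel u v -> cancel v u -> gaussian_noise P V -> gaussian_noise P (V \o u).
Proof.
move=> uK vK [mV HV]; split => [i|s A us mA]; first exact: mV.
have := HV (map u s) (A \o v); rewrite map_inj_uniq; last exact: can_inj uK.
move=> /(_ us (fun i => mA (v i))); rewrite big_map.
under eq_bigr do rewrite /= uK.
move=> <-; congr (P _); apply/seteqP; split => t /= H i.
  by move=> /mapP[j js ->] /=; rewrite uK; exact: H.
by move=> is_; have := H (u i) (map_f u is_); rewrite /= uK.
Qed.

Lemma normal_prob_opp (A : set R) : measurable A ->
  normal_prob 0 1 (-%R @^-1` A) = normal_prob 0 1 A :> \bar R.
Proof.
move=> mA; rewrite /normal_prob.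
rewrite [RHS](eq_measure_integral (pushforward lebesgue_measure (-%R : _ -> measurableTypeR R))); last first.
  by move=> B mB _; exact/esym/lebesgue_measureN.
rewrite ge0_integral_pushforward //; last first.
- by move=> x _; rewrite lee_fin normal_pdf_ge0.
- apply/measurable_EFinP; apply: measurable_funTS; exact: measurable_normal_pdf.
apply: eq_integral => x _ /=; congr EFin; rewrite !normal_pdfE ?oner_neq0 //=.
by rewrite /normal_fun !subr0 sqrrN.
Qed.

Lemma gaussian_noise_opp (d : measure_display) (T : measurableType d)
    (P : probability T R) V :
  gaussian_noise P V -> gaussian_noise P (fun i t => - V i t).
Proof.
move=> [mV HV]; split => [i|s A us mA].
  exact: measurableT_comp.
have mA' i : measurable (-%R @^-1` A i).
  by rewrite -[X in measurable X]setTI; by apply: (@oppr_measurable R).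
rewrite -(eq_bigr _ (fun i _ => normal_prob_opp (mA i))).
by rewrite -HV.
Qed.

End noise.

(** * Sums over boxes of the lattice *)

(** An enumeration that grows with [N], so that sums over boxes can be handled by
    induction and compared by inclusion. *)
Fixpoint zrange (N : nat) : seq int :=
  if N is n.+1 then n.+1%:Z :: - n.+1%:Z :: zrange n else [:: 0].

Definition zbox (N : nat) : seq (int * int) :=
  [seq (a, b) | a <- zrange N, b <- zrange N].

Lemma mem_zrange N (a : int) : (a \in zrange N) = (`|a| <= N)%N.
Proof. by elim: N => [|N IH] /=; rewrite !inE ?IH; lia. Qed.

Lemma zrange_uniq N : uniq (zrange N).
Proof. by elim: N => [//|N IH] /=; rewrite IH inE !mem_zrange; lia. Qed.

Lemma size_zrange N : size (zrange N) = (2 * N).+1.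
Proof. by elim: N => [//|N IH] /=; rewrite IH; lia. Qed.

Lemma mem_zbox N z : (z \in zbox N) = (`|z.1| <= N)%N && (`|z.2| <= N)%N.
Proof.
apply/allpairsP/idP => [[[a b] /= [aN bN ->]]|/andP[aN bN]].
  by rewrite -!mem_zrange aN.
by exists z; rewrite !mem_zrange; split => //; case: z {aN bN}.
Qed.

Lemma zbox_uniq N : uniq (zbox N).
Proof. by apply: allpairs_uniq; rewrite ?zrange_uniq // => -[a b] [c e]. Qed.

Lemma box_zbox N : box N = [set` zbox N].
Proof. by apply/seteqP; split => -[a b] /=; rewrite /box mem_zbox /= -!abszE !lez_nat; [case=> -> ->|move/andP]. Qed.

Lemma sub_zbox (s : seq (int * int)) : exists N, {subset s <= zbox N}.
Proof.
elim: s => [|z s [N IH]]; first by exists 0%N.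
case: z => a b; exists (N + `|a| + `|b|)%N => -[c e].
by rewrite inE => /orP[/eqP[-> ->]|/IH]; rewrite !mem_zbox /=; lia.
Qed.

Section lattice_sums.
Variable R : realType.

Definition norm2 (z : int * int) : R := z.1%:~R ^+ 2 + z.2%:~R ^+ 2.

Lemma ler_big_subset (J : eqType) (s s' : seq J) (F : J -> R) :
  uniq s -> {subset s <= s'} -> (forall i, 0 <= F i) ->
  \sum_(i <- s) F i <= \sum_(i <- s') F i.
Proof.
elim: s s' => [|i s IH] s' /=.
  by move=> _ _ F0; rewrite big_nil; apply: sumr_ge0.
move=> /andP[nis us] sub F0.
have is' : i \in s' by apply: sub; rewrite inE eqxx.
rewrite big_cons (perm_big _ (perm_to_rem is')) big_cons lerD2l.
apply: IH => // j js; have ne : j != i by apply: contraNneq nis => <-.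
have : j \in i :: rem i s' by rewrite -(perm_mem (perm_to_rem is')); apply: sub; rewrite inE js orbT.
by rewrite inE (negbTE ne).
Qed.

(** The correction [4 / (N + 1)] makes the induction telescope. *)
Lemma sum_inv_sqr N : \sum_(a <- zrange N) (1 + a%:~R ^+ 2 : R)^-1 <= 5 - 4 / N.+1%:R.
Proof.
elim: N => [|N IH] /=; first by rewrite big_seq1 expr0n /= addr0 invr1 ?mulr1; lra.
rewrite !big_cons rmorphN /= sqrrN; set u : R := (_)^-1.
have -> : 5 - 4 / N.+2%:R = 5 - 4 / N.+1%:R + 4 / (N.+1%:R * N.+2%:R) :> R.
  by rewrite -[N.+2%:R]natr1 -[N.+1%:R]natr1; field; rewrite !natr1 !pnatr_eq0.
move: IH; set S := \sum_(j <- _) _; set w : R := 4 / (_ * _); set c : R := 4 / _ => IH.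
suff H : 2 * u <= w by lra.
rewrite /u /w -!pmulrn -[N.+2%:R]natr1; have : (1 : R) <= N.+1%:R by rewrite ler1n.
set v : R := N.+1%:R => v1.
have vv : 0 < v * (v + 1) by nra.
by rewrite ler_pdivlMr // mulrAC ler_pdivrMr; nra.
Qed.

Lemma norm2_ge1 z : z != (0, 0) -> 1 <= norm2 z.
Proof.
case: z => a b ne; rewrite /norm2 -!rmorphXn -rmorphD /= (ler_int _ 1).
move: ne; rewrite xpair_eqE negb_and => /orP[]; nia.
Qed.

Lemma norm2_far r z : z \notin zbox r -> r%:R ^+ 2 <= norm2 z.
Proof.
case: z => a b; rewrite mem_zbox /norm2 /= => H.
rewrite -[r%:R]/((r%:Z)%:~R) -!rmorphXn -rmorphD /= ler_int.
move: H; rewrite negb_and => /orP[]; nia.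
Qed.

(** Two of the powers of [norm2] are kept for summability over the lattice, by
    comparison with a product of two convergent one-dimensional series; the others
    give the decay in [r]. *)
Lemma sum_far r k (s : seq (int * int)) : (0 < r)%N -> uniq s ->
  (forall z, z \in s -> z \notin zbox r) ->
  \sum_(z <- s) (norm2 z ^- (k + 2)) <= 100 / r%:R ^+ (2 * k).
Proof.
move=> r0 us far.
have r0' : (0 : R) < r%:R by rewrite ltr0n.
pose F z : R := 4 / (r%:R ^+ (2 * k)) * ((1 + z.1%:~R ^+ 2)^-1 * (1 + z.2%:~R ^+ 2)^-1).
have F0 z : 0 <= F z.
  apply: mulr_ge0; first by rewrite divr_ge0 // exprn_ge0 // ltW.
  by apply: mulr_ge0; rewrite invr_ge0 addr_ge0 ?sqr_ge0.
apply: (@le_trans _ _ (\sum_(z <- s) F z)).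
  rewrite big_seq [leRHS]big_seq; apply: ler_sum => z /far zr.
  have z1 : 1 <= norm2 z.
    by apply: norm2_ge1; apply: contraNneq zr => ->; rewrite mem_zbox.
  have z0 : 0 < norm2 z by lra.
  rewrite exprD invfM /F [4 / _]mulrC -mulrA; apply: ler_pM.
  - by rewrite invr_ge0 exprn_ge0 // ltW.
  - by rewrite invr_ge0 exprn_ge0 // ltW.
  - rewrite lef_pV2 ?posrE ?exprn_gt0 // exprM lerXn2r ?nnegrE ?exprn_ge0 ?(ltW r0') ?(ltW z0) //.
    exact: norm2_far.
  rewrite -invfM ler_pdivlMr; last by rewrite mulr_gt0 // ltr_wpDr ?sqr_ge0.
  rewrite mulrC ler_pdivrMr ?exprn_gt0 //; move: z1; rewrite /norm2.
  have := sqr_ge0 (z.1%:~R : R); have := sqr_ge0 (z.2%:~R : R); nra.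
have [N sN] := sub_zbox s.
apply: (le_trans (ler_big_subset us sN F0)).
rewrite /F -mulr_sumr big_allpairs_dep /=.
under eq_bigr do rewrite -mulr_sumr.
rewrite -mulr_suml.
set S := \sum_(a <- _) _.
have S0 : 0 <= S.
  by apply: sumr_ge0 => a _; rewrite invr_ge0 addr_ge0 ?sqr_ge0.
have S5 : S <= 5.
  by apply: le_trans (sum_inv_sqr N) _; rewrite gerBl divr_ge0.
have : S * S <= 25 by nra.
have : 0 <= 1 / (r%:R ^+ (2 * k) : R) by rewrite divr_ge0 // exprn_ge0 // ltW.
set e : R := r%:R ^+ (2 * k); nra.
Qed.

(** The box sums of [a + |a|] and of [|a|] are both nondecreasing and bounded. *)
Lemma cvg_box_sum (a : int * int -> R) (B : R) :
  (forall N, \sum_(y <- zbox N) `|a y| <= B) ->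
  cvgn (fun N => \sum_(y <- zbox N) a y) /\
  `|limn (fun N => \sum_(y <- zbox N) a y)| <= B.
Proof.
move=> aB.
have sub m n : (m <= n)%N -> {subset zbox m <= zbox n} by move=> mn z; rewrite !mem_zbox; lia.
have c1 : cvgn (fun N => \sum_(y <- zbox N) `|a y|).
  apply: nondecreasing_is_cvgn.
    by move=> m n mn; apply: ler_big_subset; [exact: zbox_uniq|exact: sub|].
  by exists B => _ [N _ <-].
have c2 : cvgn (fun N => \sum_(y <- zbox N) (a y + `|a y|)).
  apply: nondecreasing_is_cvgn.
    move=> m n mn; apply: ler_big_subset; [exact: zbox_uniq|exact: sub|] => i.
    by have := lerNnormlW (lexx `|a i|); lra.
  exists (B + B) => _ [N _ <-]; rewrite big_split; apply: lerD => //.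
  by apply: le_trans (aB N); apply: ler_sum => i _; exact: ler_norm.
have c : cvgn (fun N => \sum_(y <- zbox N) a y).
  have -> : (fun N => \sum_(y <- zbox N) a y) =
    (fun N => \sum_(y <- zbox N) (a y + `|a y|)) - (fun N => \sum_(y <- zbox N) `|a y|).
    by apply/funext => N; rewrite !fctE big_split /= addrK.
  exact: is_cvgB.
have nB N : `|\sum_(y <- zbox N) a y| <= B by apply: le_trans (ler_norm_sum _ _ _) (aB N).
split => //; rewrite ler_norml; apply/andP; split.
  by apply: limr_ge => //; near=> N; have := nB N; rewrite ler_norml => /andP[].
by apply: limr_le => //; near=> N; have := nB N; rewrite ler_norml => /andP[].
Unshelve. all: by end_near. Qed.

End lattice_sums.

(** * Normal estimates *)

Section gaussian_estimates.
Variable R : realType.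

Lemma normal_interval_le (a b : R) : a <= b ->
  (normal_prob 0 1 `[a, b] <= (normal_peak 1 * (b - a))%:E :> \bar R)%E.
Proof.
move=> ab; rewrite /normal_prob.
apply: (@le_trans _ _ (\int[lebesgue_measure]_(x in `[a, b]) (normal_peak 1 : R)%:E)%E).
  apply: ge0_le_integral => //=.
  - by move=> x _; rewrite lee_fin normal_pdf_ge0.
  - by apply/measurable_EFinP; apply: measurable_funTS; exact: measurable_normal_pdf.
  - by move=> x _; rewrite lee_fin; apply: normal_pdf_ub; rewrite oner_neq0.
rewrite integral_cst //= lebesgue_measure_itv /= lte_fin.
case: ltP => h; first by rewrite -EFinD -EFinM.
by rewrite mule0 lee_fin mulr_ge0 ?subr_ge0 // normal_peak_ge0.
Qed.

(** A factor [exp (- 3 x^2 / 8)] is extracted from the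
    density, which leaves a normal density of standard deviation 2 and hence a
    total mass at most 1. *)
Lemma normal_tail : exists2 C : R, 0 < C & forall a, 0 < a ->
  (normal_prob 0 1 [set v : R | (a < `|v|)%R] <= (C / a ^+ 2)%:E :> \bar R)%E.
Proof.
have p1 : 0 < normal_peak (1 : R) by rewrite normal_peak_gt0 ?oner_neq0.
have p2 : 0 < normal_peak (2 : R) by rewrite normal_peak_gt0 ?pnatr_eq0.
pose C := 3 * (normal_peak 1 / normal_peak 2) : R.
exists C => [|a a0]; first by rewrite /C mulr_gt0 // divr_gt0.
have C0 : 0 <= C / a ^+ 2 by rewrite divr_ge0 ?sqr_ge0 // /C mulr_ge0 // divr_ge0 // ltW.
have mA : measurable [set v : R | (a < `|v|)%R].
  rewrite (_ : [set _ | _] = Num.norm @^-1` `]a, +oo[).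
    by rewrite -[X in measurable X]setTI; exact: (@normr_measurable R setT).
  by apply/seteqP; split => v /=; rewrite in_itv /= andbT.
rewrite /normal_prob.
apply: (@le_trans _ _ (\int[lebesgue_measure]_(x in [set v : R | (a < `|v|)%R])
    ((C / a ^+ 2)%:E * (normal_pdf 0 2 x)%:E))%E).
  apply: ge0_le_integral => //=.
  - by move=> x _; rewrite lee_fin normal_pdf_ge0.
  - by apply/measurable_EFinP; apply: measurable_funTS; exact: measurable_normal_pdf.
  - apply: emeasurable_funM => //; apply/measurable_EFinP; apply: measurable_funTS; exact: measurable_normal_pdf.
  move=> x ax; rewrite -EFinM lee_fin !normal_pdfE ?oner_neq0 ?pnatr_eq0 //=.
  rewrite /normal_fun !subr0.
  have xa : a ^+ 2 <= x ^+ 2.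
    rewrite -[x ^+ 2]real_normK ?num_real // lerXn2r ?nnegrE ?(ltW a0) // ltW //.
  set y := x ^+ 2 in xa *; have a20 : 0 < a ^+ 2 by rewrite exprn_gt0.
  (* [x^2 / 2 = 3 x^2 / 8 + x^2 / 8], and 8 is twice the square of 2. *)
  have -> : - y / (1 ^+ 2 *+ 2) = - (3 / 8 * y) + - y / (2 ^+ 2 *+ 2) by field.
  rewrite expRD mulrA [leRHS]mulrA.
  apply: ler_wpM2r; first exact: expR_ge0.
  have -> : C / a ^+ 2 * normal_peak 2 = normal_peak 1 * (3 / a ^+ 2).
    by rewrite /C; field; rewrite !gt_eqF.
  rewrite ler_pM2l // expRN.
  have : 1 + 3 / 8 * y <= expR (3 / 8 * y) := expR_ge1Dx _.
  move=> h; rewrite -[3 / a ^+ 2]invrK lef_pV2 ?posrE ?expR_gt0 ?invr_gt0 ?divr_gt0 //.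
  by rewrite invf_div ler_pdivrMr //; nra.
rewrite ge0_integralZl //.
- apply: (@le_trans _ _ ((C / a ^+ 2)%:E * 1)%E); last by rewrite mule1.
  apply: lee_wpmul2l; first by rewrite lee_fin.
  exact: (@probability_le1 _ _ _ (normal_prob 0 2)).
- apply/measurable_EFinP; apply: measurable_funTS; exact: measurable_normal_pdf.
- by move=> x _; rewrite lee_fin normal_pdf_ge0.
Qed.

End gaussian_estimates.

(** * The truncated field *)

Section truncation.
Variables (R : realType) (q : int * int -> R) (c3 : R).
Hypothesis q_ge0 : forall x, 0 <= q x.
Hypothesis q_gt0 : 0 < q (0, 0).
Hypothesis c3_gt0 : 0 < c3.
Hypothesis q_decay : forall z, z != (0, 0) -> q z <= c3 * norm2 R z ^- 25.

Definition trunc r (w : int * int -> R) (x : int * int) :=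
  \sum_(z <- zbox r) q z * w (x - z).

Lemma norm2_gt0_far r z : z \notin zbox r -> 0 < norm2 R z /\ z != (0, 0).
Proof.
move=> zr; have z0 : z != (0, 0) by apply: contraNneq zr => ->; rewrite mem_zbox.
by split => //; apply: lt_le_trans (norm2_ge1 R z0).
Qed.

(** On the event that the far noise grows at most polynomially the series converges
    absolutely and its tail is controlled deterministically.  The exponent 8 in the
    growth is a compromise: it leaves [norm2^-17] in the series and gives the
    summable probabilities [norm2^-16] in [noise_tail]. *)
Lemma noise_convolution_trunc r w x : (0 < r)%N ->
  (forall z, z \notin zbox r -> `|w (x - z)| <= norm2 R z ^+ 8) ->
  `|noise_convolution q w x - trunc r w x| <= 100 * c3 / r%:R ^+ 30.
Proof.
move=> r0 wb.
(* The part of the series outside the window [x + zbox r]; the window itself is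
   contained in [zbox N] for large [N] and contributes exactly [trunc r w x]. *)
pose a y := if x - y \in zbox r then 0 else q (x - y) * w y.
have aB N : \sum_(y <- zbox N) `|a y| <= 100 * c3 / r%:R ^+ 30.
  pose s := [seq x - y | y <- zbox N & x - y \notin zbox r].
  have us : uniq s.
    rewrite map_inj_uniq; first exact/filter_uniq/zbox_uniq.
    by move=> u v /(congr1 (fun z => x - z)); rewrite !subKr.
  have H := @sum_far R r 15 s r0 us.
  rewrite [leRHS](_ : _ = c3 * (100 / r%:R ^+ (2 * 15))); last by rewrite mulrA [c3 * _]mulrC.
  apply: (@le_trans _ _ (c3 * \sum_(z <- s) norm2 R z ^- (15 + 2))).
    rewrite mulr_sumr big_map big_filter [leRHS]big_mkcond /=.
    apply: ler_sum => y _; rewrite /a; case: ifPn => [|far] /=; first by rewrite normr0.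
    have [n0 z0] := norm2_gt0_far far.
    have -> : norm2 R (x - y) ^- (15 + 2) = norm2 R (x - y) ^- 25 * norm2 R (x - y) ^+ 8.
      have E : norm2 R (x - y) ^+ 25 = norm2 R (x - y) ^+ (15 + 2) * norm2 R (x - y) ^+ 8 by rewrite -exprD.
      by rewrite E [in RHS]invfM mulfVK // expf_neq0 // gt_eqF.
    rewrite normrM mulrA; apply: ler_pM => //; first by rewrite ger0_norm ?q_decay.
    by have := wb _ far; rewrite subKr.
  by rewrite ler_pM2l //; apply: H => z /mapP[y]; rewrite mem_filter => /andP[? _] ->.
have [ca la] := cvg_box_sum aB.
suff -> : noise_convolution q w x = trunc r w x + limn (fun N => \sum_(y <- zbox N) a y).
  by rewrite addrC addKr.
apply/cvg_lim => //.
have key : (fun N => trunc r w x + \sum_(y <- zbox N) a y) @ \oo -->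
   trunc r w x + limn (fun N => \sum_(y <- zbox N) a y).
  by apply: cvgD => //; exact: cvg_cst.
apply: cvg_trans key; apply: near_eq_cvg.
near=> N; apply: esym.
rewrite box_zbox -fsbig_seq ?zbox_uniq //.
rewrite (bigID (fun y => x - y \in zbox r)) /=; congr (_ + _).
  have p : perm_eq [seq y <- zbox N | x - y \in zbox r] [seq x - z | z <- zbox r].
    apply: uniq_perm; first exact/filter_uniq/zbox_uniq.
      rewrite map_inj_uniq ?zbox_uniq //.
      by move=> u v /(congr1 (fun z => x - z)); rewrite !subKr.
    move=> y; rewrite mem_filter; apply/andP/mapP => [[yr _]|[z zr ->]].
      by exists (x - y); rewrite ?subKr.
    rewrite subKr; split => //.
    have hN : (r + `|x.1| + `|x.2| <= N)%N by near: N; exact: nbhs_infty_ge.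
    by move: zr; rewrite !mem_zbox /=; clear -hN; case: x hN => x1 x2; case: z => z1 z2 /=; lia.
  rewrite -big_filter (perm_big _ p) big_map; apply: eq_bigr => z _; by rewrite subKr.
rewrite [RHS](bigID (fun y => x - y \in zbox r)) /= [X in _ = X + _]big1 ?add0r.
  by apply: eq_bigr => y; rewrite /a => /negbTE ->.
by move=> y; rewrite /a => ->.
Unshelve. all: by end_near. Qed.

End truncation.

(** * Stability of the signs under truncation *)

Lemma measure_union_seq (d : measure_display) (T : measurableType d) (R : realType)
  (mu : {measure set T -> \bar R}) (J : eqType) (s : seq J) (A : J -> set T)
  (c : J -> R) :
  (forall j, j \in s -> measurable (A j) /\ (mu (A j) <= (c j)%:E)%E) ->
  measurable [set t | exists2 j, j \in s & A j t] /\
  (mu [set t | exists2 j, j \in s & A j t] <= (\sum_(j <- s) c j)%:E)%E.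
Proof.
elim: s => [|j s IH] H.
  rewrite (_ : [set t | _] = set0); last by apply/seteqP; split => t // [].
  by rewrite big_nil measure0.
have [mj cj] := H j (mem_head _ _).
have [|ms cs] := IH; first by move=> i is_; apply: H; rewrite inE is_ orbT.
rewrite (_ : [set t | _] = A j `|` [set t | exists2 j, j \in s & A j t]); last first.
  apply/seteqP; split => t /=.
    by move=> [i]; rewrite inE => /orP[/eqP ->|]; [left|right; exists i].
  by move=> [?|[i is_ Ai]]; [exists j; rewrite ?mem_head|exists i; rewrite // inE is_ orbT].
split; first exact: measurableU.
apply: (le_trans (measureU2 mu mj ms)).
by rewrite big_cons EFinD; apply: leeD.
Qed.

Section noise_events.
Variables (R : realType) (q : int * int -> R) (c3 : R).
Hypothesis q_ge0 : forall x, 0 <= q x.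
Hypothesis q_gt0 : 0 < q (0, 0).
Hypothesis c3_gt0 : 0 < c3.
Hypothesis q_decay : forall z, z != (0, 0) -> q z <= c3 * norm2 R z ^- 25.

Local Notation lattice := (int * int)%type.

Lemma measurable_trunc r x :
  measurable_fun setT (fun w : noise_space R lattice => trunc q r w x).
Proof.
apply: measurable_sum => z; apply: measurable_funM => //.
exact: measurable_coordinate.
Qed.

Lemma gaussian_noise_marginal (I : choiceType) (d : measure_display) (T : measurableType d)
    (P : probability T R) (V : I -> T -> R) i (A : set R) :
  gaussian_noise P V -> measurable A -> P [set t | A (V i t)] = normal_prob 0 1 A.
Proof.
move=> [_ HV] mA; have := HV [:: i] (fun=> A) isT (fun=> mA); rewrite big_seq1 => <-.
congr (P _); apply/seteqP; split => t /= => [At j|H].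
  by rewrite inE => /eqP ->.
exact: (H i (mem_head _ _)).
Qed.

(** Conditionally on all other coordinates, the truncated field at [x] is an affine
    function of the coordinate [V x] with slope [q (0, 0) > 0], so its law has a
    density bounded by that of the normal law divided by the slope. *)
Lemma trunc_small_ball (d : measure_display) (T : measurableType d)
    (P : probability T R) V r x s : gaussian_noise P V -> 0 <= s ->
  (P [set t | `|trunc q r (V^~ t) x| <= s]%R <= (normal_peak 1 * (2 * s / q (0, 0)))%:E)%E.
Proof.
move=> nV s0.
pose B : set (noise_space R lattice) := [set w | `|trunc q r w x| <= s].
have mB : measurable B.
  rewrite (_ : B = (fun w => `|trunc q r w x|) @^-1` `]-oo, s]); last first.
    by apply/seteqP; split => w /=; rewrite in_itv.
  rewrite -[X in measurable X]setTI.
  have : measurable_fun setT (fun w : noise_space R lattice => `|trunc q r w x|).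
    by apply: measurableT_comp => //; exact: measurable_trunc.
  by apply.
(* Only the coordinate at [x] is taken from the second copy. *)
have nU := @gaussian_noise_resample _ _ _ _ P V (predC1 x) nV.
rewrite (gaussian_noise_law nV nU mB).
set A := [set t | _].
have mA : measurable A.
  have := measurable_to_noise (proj1 nU); rewrite /measurable_fun => /(_ measurableT B mB).
  by rewrite setTI.
have mxA t : measurable (xsection A t) by exact: measurable_xsection.
have key t : (P (xsection A t) <= (normal_peak 1 * (2 * s / q (0, 0)))%:E)%E.
  pose c := \sum_(z <- zbox r | z != (0, 0)) q z * V (x - z) t.
  pose a := (- s - c) / q (0, 0); pose b := (s - c) / q (0, 0).
  have split_site u : trunc q r (fun i => if i != x then V i t else V i u) x =
      q (0, 0) * V x u + c.
    rewrite /trunc (bigD1_seq (0, 0)) ?zbox_uniq ?mem_zbox //= subr0 eqxx /=.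
    congr (_ + _); apply: eq_bigr => z z0; rewrite ifT //.
    by rewrite -subr_eq0 addrAC subrr sub0r oppr_eq0.
  have -> : xsection A t = [set u | `[a, b]%classic (V x u)].
    apply/predeqP => u; rewrite /xsection /= inE /A /B /= split_site in_itv /=.
    by rewrite ler_norml /a /b ler_pdivrMr // ler_pdivlMr // lerBlDr lerBrDr [_ * q _]mulrC.
  rewrite (gaussian_noise_marginal x nV) //.
  apply: le_trans (normal_interval_le _) _.
    by rewrite /a /b ler_pM2r ?invr_gt0 // lerD2r; lra.
  by rewrite lee_fin /a /b -mulrBl (_ : s - c - _ = 2 * s) //; lra.
apply: (@le_trans _ _ (\int[P]_t (normal_peak 1 * (2 * s / q (0, 0)))%:E)%E).
  apply: (@ge0_le_integral _ _ _ P setT) => //.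
    exact: measurable_fun_xsection.
  by move=> t _; exact: key.
by rewrite integral_cst // [X in (_ * X)%E](probability_setT P) mule1.
Qed.

(** Union bound over the sites outside the window, first in finite boxes and then by
    continuity from below. *)
Lemma noise_tail (C : R) (d : measure_display) (T : measurableType d)
    (P : probability T R) V r x : 0 < C ->
  (forall a : R, 0 < a -> (normal_prob 0 1 [set v : R | (a < `|v|)%R] <= (C / a ^+ 2)%:E :> \bar R)%E) ->
  (0 < r)%N -> gaussian_noise P V ->
  let E := [set t | exists z, z \notin zbox r /\ norm2 R z ^+ 8 < `|V (x - z) t| ] in
  measurable E /\ (P E <= (100 * C / r%:R ^+ 28)%:E)%E.
Proof.
move=> C0 HC r0 nV E.
pose s N := [seq z <- zbox N | z \notin zbox r].
pose A z := [set t | norm2 R z ^+ 8 < `|V (x - z) t| ].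
pose E' N := [set t | exists2 z, z \in s N & A z t].
have mabs (a : R) : measurable [set v : R | (a < `|v|)%R].
  rewrite (_ : [set _ | _] = Num.norm @^-1` `]a, +oo[).
    by rewrite -[X in measurable X]setTI; exact: (@normr_measurable R setT).
  by apply/seteqP; split => v /=; rewrite in_itv /= andbT.
have mA z : measurable (A z).
  by rewrite -[X in measurable X]setTI; exact: (proj1 nV (x - z) measurableT _ (mabs _)).
have HE N : measurable (E' N) /\ (P (E' N) <= (\sum_(z <- s N) C * norm2 R z ^- (14 + 2))%:E)%E.
  apply: measure_union_seq => z; rewrite mem_filter => /andP[zr _]; split => //.
  have [n0 _] := norm2_gt0_far R zr.
  rewrite [leLHS](_ : _ = normal_prob 0 1 [set v : R | (norm2 R z ^+ 8 < `|v|)%R]); last first.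
    exact: (gaussian_noise_marginal (x - z) nV (mabs (norm2 R z ^+ 8))).
  by apply: le_trans (HC _ _) _; rewrite ?exprn_gt0 // -exprM.
have HE' N : (P (E' N) <= (100 * C / r%:R ^+ 28)%:E)%E.
  apply: le_trans (proj2 (HE N)) _; rewrite lee_fin -mulr_sumr.
  rewrite [leRHS](_ : _ = C * (100 / r%:R ^+ (2 * 14))); last by rewrite mulrA [C * _]mulrC.
  rewrite ler_pM2l //; apply: sum_far => //; first exact/filter_uniq/zbox_uniq.
  by move=> z; rewrite mem_filter => /andP[].
have EE : E = \bigcup_N E' N.
  apply/seteqP; split => t /=.
    move=> [z [zr Az]]; exists (`|z.1| + `|z.2|)%N => //; exists z => //.
    by rewrite mem_filter zr mem_zbox leq_addr leq_addl.
  by move=> [N _ [z]]; rewrite mem_filter => /andP[zr _] Az; exists z.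
have mE : measurable E by rewrite EE; apply: bigcupT_measurable => N; case: (HE N).
split => //.
have c : P (E' N) @[N --> \oo] --> P E.
  rewrite EE; apply: nondecreasing_cvg_mu => //.
  - by move=> N; case: (HE N).
  - by rewrite -EE.
  - move=> m n mn; apply/subsetPset => t /= [z]; rewrite mem_filter => /andP[zr].
    rewrite mem_zbox => /andP[z1 z2] Az; exists z => //.
    by rewrite mem_filter zr mem_zbox (leq_trans z1 mn) (leq_trans z2 mn).
have := cvg_lim (@ereal_hausdorff R) c => <-.
apply: lime_le; first by apply/cvg_ex; eexists; exact: c.
by near=> N.
Unshelve. all: by end_near. Qed.

(** The sign can change only if the truncated field is not larger than the tail of
    the series.  Both that event and the exceptional event of [noise_tail] are unlikely. *)
Lemma sign_stable : exists2 K : R, 0 < K &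
  forall (d : measure_display) (T : measurableType d) (P : probability T R) V r x,
  (0 < r)%N -> gaussian_noise P V ->
  exists B : set T, [/\ measurable B, (P B <= (K / r%:R ^+ 28)%:E)%E &
    forall t, ~ B t -> Num.sg (noise_convolution q (V^~ t) x) = Num.sg (trunc q r (V^~ t) x)].
Proof.
have [C C0 HC] := normal_tail R.
have p1 : 0 < normal_peak (1 : R) by rewrite normal_peak_gt0 ?oner_neq0.
exists (normal_peak 1 * (2 * (100 * c3) / q (0, 0)) + 100 * C).
  apply: addr_gt0; apply: mulr_gt0 => //; apply: divr_gt0 => //.
  by rewrite !mulr_gt0.
move=> d T P V r x r0 nV.
have r0' : (0 : R) < r%:R by rewrite ltr0n.
(* The bound of [noise_convolution_trunc] on the tail. *)
pose s := 100 * c3 / r%:R ^+ 30 : R.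
have s0 : 0 <= s by rewrite /s divr_ge0 ?exprn_ge0 ?ltW // mulr_gt0.
have [mE PE] := noise_tail x C0 HC r0 nV.
set E := [set t | _] in mE PE.
pose B := [set t | `|trunc q r (V^~ t) x| <= s].
have mB : measurable B.
  rewrite -[X in measurable X]setTI.
  have : measurable_fun setT (fun t => `|trunc q r (V^~ t) x|).
    apply: measurableT_comp => //.
    exact: (measurableT_comp (measurable_trunc r x) (measurable_to_noise (proj1 nV))).
  move=> /(_ measurableT `]-oo, s]%classic (measurable_itv _)).
  have -> // : (fun t => `|trunc q r (V^~ t) x|) @^-1` `]-oo, s]%classic = B.
  by apply/seteqP; split => t /=; rewrite in_itv.
exists (B `|` E); split; first exact: measurableU.
  apply: (le_trans (measureU2 P mB mE)).
  have PB := trunc_small_ball r x nV s0.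
  apply: (le_trans (leeD PB PE)).
  rewrite -EFinD lee_fin [leRHS]mulrDl; apply: lerD => //.
  set u := normal_peak 1 * (2 * (100 * c3) / q (0, 0)).
  have -> : normal_peak 1 * (2 * s / q (0, 0)) = u / r%:R ^+ 30.
    by rewrite /s /u; field; rewrite !gt_eqF.
  apply: ler_wpM2l; first by rewrite mulr_ge0 ?divr_ge0 ?mulr_ge0 // ltW.
  by rewrite lef_pV2 ?posrE ?exprn_gt0 // ler_weXn2l // ler1n.
move=> t nBE.
have sB : s < `|trunc q r (V^~ t) x|.
  by rewrite ltNge; apply/negP => H; apply: nBE; left.
have far z : z \notin zbox r -> `|V (x - z) t| <= norm2 R z ^+ 8.
  by move=> zr; rewrite leNgt; apply/negP => H; apply: nBE; right; exists z.
have := @noise_convolution_trunc _ _ _ q_ge0 c3_gt0 q_decay r (V^~ t) x r0 far; rewrite -/s.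
move: sB; set g := noise_convolution _ _ _; set h := trunc _ _ _ _ => sB /le_lt_trans/(_ sB).
case: (ltgtP h 0) sB => [h0|h0|->]; last by rewrite normr0; lra.
- by rewrite (ltr0_norm h0) ltr_norml => _ /andP[? ?]; rewrite !ltr0_sg //; lra.
- by rewrite (gtr0_norm h0) ltr_norml => _ /andP[? ?]; rewrite !gtr0_sg //; lra.
Qed.

Definition truncation_error (K : R) r n : R := K * ((2 * n).+1 * n)%:R / r%:R ^+ 28.

(** The sites [(a, k)] with [k < n] and [|a| <= n] contain the cone reachable in [n] steps;
    [2 n + 1] times [n] is their number. *)
Definition truncation_stable (K : R) (d : measure_display) (T : measurableType d)
    (P : probability T R) (V : lattice -> T -> R) :=
  forall r n, (0 < r)%N ->
  exists B : set T, [/\ measurable B, (P B <= (truncation_error K r n)%:E)%E &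
    forall t, ~ B t -> forall (k : nat) (a : int), (k < n)%N -> (`|a| <= n)%N ->
      Num.sg (noise_convolution q (V^~ t) (a, k%:Z)) = Num.sg (trunc q r (V^~ t) (a, k%:Z))].

Lemma sign_stable_cone : exists2 K : R, 0 < K &
  forall (d : measure_display) (T : measurableType d) (P : probability T R) V,
  gaussian_noise P V -> truncation_stable K P V.
Proof.
have [K K0 HK] := sign_stable; exists K => // d T P V nV r n r0.
have ch x : {B : set T | [/\ measurable B, (P B <= (K / r%:R ^+ 28)%:E)%E &
    forall t, ~ B t -> Num.sg (noise_convolution q (V^~ t) x) = Num.sg (trunc q r (V^~ t) x)]}.
  exact: cid (HK _ _ P V r x r0 nV).
pose B x := projT1 (ch x).
pose s : seq (int * int) := [seq (a, k%:Z) | a <- zrange n, k <- iota 0 n].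
have [mU PU] := @measure_union_seq _ _ _ P _ s B (fun=> K / r%:R ^+ 28)
  (fun x _ => let: And3 m p _ := projT2 (ch x) in conj m p).
exists [set t | exists2 x, x \in s & B x t]; split => //.
  apply: le_trans PU _; rewrite lee_fin big_const_seq iter_addr addr0.
  by rewrite count_predT size_allpairs size_zrange size_iota -[leLHS]mulr_natr mulrAC.
move=> t nB k a kn an; case: (projT2 (ch (a, k%:Z))) => _ _; apply => Bt.
by apply: nB; exists (a, k%:Z) => //; apply: allpairs_f; rewrite ?mem_zrange // mem_iota.
Qed.

End noise_events.

(** * Symmetries and decoupling of the truncated environment *)

Section environment.
Variables (R : realType) (q : int * int -> R) (delta : R).
Hypothesis q_sym : forall x1 x2 : int, q (x1, x2) = q (- x1, x2).
Hypothesis delta01 : 0 <= delta <= 1 / 2.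

Local Notation lattice := (int * int)%type.

(** [g] is the field itself, not its sign: [Num.sg] is evaluated here so that the
    truncated and the full field can be compared through their signs. *)
Definition step_right (g : lattice -> R) (k : nat) (x : int) : R :=
  1 / 2 + delta * Num.sg (g (x, k%:Z)).

Lemma normr_sg_le1 (v : R) : `|Num.sg v| <= 1.
Proof. by rewrite normr_sg; case: (v != 0); rewrite ?ler01 ?lexx. Qed.

Lemma step_right_dist g k x : `|step_right g k x - 1 / 2| <= delta.
Proof.
have /andP[d0 _] := delta01.
rewrite /step_right addrAC subrr add0r normrM (ger0_norm d0) ler_piMr //.
exact: normr_sg_le1.
Qed.

Lemma step_right_prob g : is_prob (step_right g).
Proof.
move=> k x; have := step_right_dist g k x; have /andP[d0 d1] := delta01.
by rewrite ler_norml => /andP[? ?]; apply/andP; split; lra.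
Qed.

Lemma bounded_measurable_sg (d : measure_display) (T : measurableType d) (F : T -> R) :
  measurable_fun setT F -> bounded_measurable (fun t => Num.sg (F t)).
Proof.
move=> mF.
have E : (fun t => Num.sg (F t)) = (fun t => \1_(F @^-1` `]0, +oo[) t + (-1) * \1_(F @^-1` `]-oo, 0[) t).
  apply/funext => t; rewrite !indicE.
  have -> : (t \in F @^-1` `]0, +oo[) = (0 < F t).
    by apply/idP/idP; rewrite inE /= in_itv /= andbT.
  have -> : (t \in F @^-1` `]-oo, 0[) = (F t < 0).
    by apply/idP/idP; rewrite inE /= in_itv.
  by case: sgrP => _ /=; lra.
rewrite E; apply: bounded_measurableD.
  by apply: bounded_measurable_indic; rewrite -[X in measurable X]setTI; exact: mF.
apply: bounded_measurableM; first exact: bounded_measurable_cst.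
by apply: bounded_measurable_indic; rewrite -[X in measurable X]setTI; exact: mF.
Qed.

Definition truncated_env r (w : lattice -> R) := step_right (trunc q r w).

Lemma bounded_measurable_env r k x :
  bounded_measurable (fun w : noise_space R lattice => truncated_env r w k x).
Proof.
apply: bounded_measurableD; first exact: bounded_measurable_cst.
apply: bounded_measurableM; first exact: bounded_measurable_cst.
apply: bounded_measurable_sg; exact: measurable_trunc.
Qed.

Lemma bounded_measurable_quenched r n k (h : noise_space R lattice -> int -> R) x :
  (forall y, bounded_measurable (h^~ y)) ->
  bounded_measurable (fun w : noise_space R lattice => walk_exp (truncated_env r w) n k (h w) x).
Proof. by move=> bh; apply: bounded_measurable_walk_exp => // j y; exact: bounded_measurable_env. Qed.

Lemma env_local r w w' k x :
  (forall z : lattice, k%:Z - r%:Z <= z.2 -> z.2 <= k%:Z + r%:Z -> w z = w' z) ->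
  truncated_env r w k x = truncated_env r w' k x.
Proof.
move=> ww'; rewrite /truncated_env /step_right; congr (_ + _ * Num.sg _).
rewrite /trunc big_seq [RHS]big_seq; apply: eq_bigr => -[a b]; rewrite mem_zbox /= => /andP[_ br].
by rewrite ww' //=; lia.
Qed.

Lemma env_shift r w k j x y :
  truncated_env r w (j + k)%N (y + x) = truncated_env r (fun z => w (z + (x, k%:Z))) j y.
Proof.
rewrite /truncated_env /step_right; congr (_ + _ * Num.sg _); apply: eq_bigr => z _.
by congr (_ * w _); rewrite addrAC; congr (_ - _); rewrite PoszD.
Qed.

(** Reflecting the walk exchanges left and right steps, which amounts to reflecting
    the noise in space, using the symmetry of [q], and changing its sign. *)
Lemma env_reflect r w k x :
  1 - truncated_env r w k (- x) = truncated_env r (fun z => - w (- z.1, z.2)) k x.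
Proof.
rewrite /truncated_env /step_right.
suff -> : trunc q r (fun z => - w (- z.1, z.2)) (x, k%:Z) = - trunc q r w (- x, k%:Z).
  by rewrite sgrN; lra.
pose u (z : lattice) : lattice := (- z.1, z.2).
have uK : involutive u by case=> a b; rewrite /u /= opprK.
have p : perm_eq (map u (zbox r)) (zbox r).
  apply: uniq_perm; rewrite ?map_inj_uniq ?zbox_uniq //; first exact: inv_inj.
  move=> z; rewrite -[z in LHS]uK mem_map; last exact: inv_inj.
  by case: z => a b; rewrite !mem_zbox /=; lia.
rewrite /trunc -(perm_big _ p) big_map -sumrN; apply: eq_bigr => -[a b] _.
rewrite /u /= -q_sym mulrN; congr (- (_ * w _)).
by congr pair => /=; lia.
Qed.

Section annealed_walk.
Context (d : measure_display) (T : measurableType d) (P : probability T R).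
Variable V : lattice -> T -> R.
Hypothesis nV : gaussian_noise P V.

Definition annealed_exp r n (h : int -> R) : R :=
  mean P (fun t => walk_exp (truncated_env r (V^~ t)) n 0 h 0).

Lemma bounded_measurable_noise (Phi : noise_space R lattice -> R) :
  bounded_measurable Phi -> bounded_measurable (fun t => Phi (V^~ t)).
Proof.
move=> [mPhi [M HM]]; split; last by exists M.
exact: (measurableT_comp mPhi (measurable_to_noise (proj1 nV))).
Qed.

Lemma bounded_measurable_walk_noise r n k h x :
  bounded_measurable (fun t => walk_exp (truncated_env r (V^~ t)) n k h x).
Proof.
apply: (bounded_measurable_noise (Phi := fun w => walk_exp (truncated_env r w) n k h x)).
by apply: bounded_measurable_quenched => y; exact: bounded_measurable_cst.
Qed.

Lemma annealed_exp_shift r n k h x :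
  mean P (fun t => walk_exp (truncated_env r (V^~ t)) n k h x) = annealed_exp r n (fun y => h (y + x)).
Proof.
pose u (z : lattice) := z + (x, k%:Z).
pose v (z : lattice) := z - (x, k%:Z).
have uK : cancel u v by move=> z; rewrite /u /v addrK.
have vK : cancel v u by move=> z; rewrite /u /v subrK.
have nU := gaussian_noise_reindex uK vK nV.
rewrite /annealed_exp.
rewrite (mean_gaussian_noise nV nU (Phi := fun w => walk_exp (truncated_env r w) n 0 (fun y => h (y + x)) 0)).
  apply: mean_ext => t.
  have := walk_exp_shift (truncated_env r (V^~ t)) n k 0 h x 0; rewrite !add0r add0n => ->.
  by apply: walk_exp_ext => // j y _ _; exact: env_shift.
by apply: bounded_measurable_quenched => y; exact: bounded_measurable_cst.
Qed.

Lemma annealed_exp_opp r n h : annealed_exp r n h = annealed_exp r n (fun y => h (- y)).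
Proof.
pose u (z : lattice) : lattice := (- z.1, z.2).
have uK : cancel u u by case=> a b; rewrite /u /= opprK.
have nU := gaussian_noise_opp (gaussian_noise_reindex uK uK nV).
rewrite /annealed_exp.
rewrite [RHS](mean_gaussian_noise nV nU (Phi := fun w => walk_exp (truncated_env r w) n 0 (fun y => h (- y)) 0)).
  apply: mean_ext => t; rewrite walk_exp_opp oppr0.
  by apply: walk_exp_ext => // j y _ _; exact: env_reflect.
by apply: bounded_measurable_quenched => y; exact: bounded_measurable_cst.
Qed.

Lemma annealed_exp_lin r n a b h h' :
  annealed_exp r n (fun y => a * h y + b * h' y) = a * annealed_exp r n h + b * annealed_exp r n h'.
Proof.
rewrite /annealed_exp -mean_lin; [|exact: bounded_measurable_walk_noise..].
by apply: mean_ext => t; rewrite walk_exp_lin.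
Qed.

Lemma annealed_exp_cst r n a : annealed_exp r n (fun=> a) = a.
Proof.
rewrite /annealed_exp -[RHS](mean_cst P a).
by apply: mean_ext => t; rewrite walk_exp_cst.
Qed.

(** The reflection symmetry of the annealed walk turns the expectation into its opposite. *)
Lemma annealed_exp_sin r n th : annealed_exp r n (fun y => sin (th * y%:~R)) = 0.
Proof.
have : annealed_exp r n (fun y => sin (th * y%:~R)) = - annealed_exp r n (fun y => sin (th * y%:~R)).
  rewrite {1}annealed_exp_opp -[RHS]mulN1r -[RHS]addr0 -[X in _ = _ + X](mul0r (annealed_exp r n (fun=> 0))).
  rewrite -annealed_exp_lin; congr annealed_exp; apply/funext => y.
  by rewrite rmorphN /= mulrN sinN mulr0 addr0 mulN1r.
lra.
Qed.

(** Real because the annealed law of the walk is symmetric; this is the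
    characteristic function of the position at time [n]. *)
Definition charf r n th := annealed_exp r n (fun y => cos (th * y%:~R)).

Lemma annealed_exp_cos_shift r n th (x : int) :
  annealed_exp r n (fun y => cos (th * (y + x)%:~R)) = cos (th * x%:~R) * charf r n th.
Proof.
rewrite /charf -[RHS]addr0 -(mulr0 (- sin (th * x%:~R))) -(annealed_exp_sin r n th) -annealed_exp_lin.
by congr annealed_exp; apply/funext => y; rewrite rmorphD /= mulrDr cosD; ring.
Qed.

(** The first [n] steps see only the noise at times before [n + r]; the noise from
    time [n + r] on may therefore be replaced by an independent copy. *)
Lemma annealed_decouple r n (K : noise_space R lattice -> int -> R) :
  (forall y, bounded_measurable (K^~ y)) ->
  (forall w w' y, (forall z : lattice, (n + r)%:Z <= z.2 -> w z = w' z) -> K w y = K w' y) ->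
  mean P (fun t => walk_exp (truncated_env r (V^~ t)) n 0 (K (V^~ t)) 0) =
  annealed_exp r n (fun y => mean P (fun t => K (V^~ t) y)).
Proof.
move=> bK Kloc.
pose S (z : lattice) := z.2 < (n + r)%:Z.
have nU := gaussian_noise_resample S nV.
have bPhi : bounded_measurable (fun w : noise_space R lattice => walk_exp (truncated_env r w) n 0 (K w) 0).
  exact: bounded_measurable_quenched.
rewrite (mean_gaussian_noise nV nU bPhi) mean_fubini; last first.
  case: bPhi => mPhi [M HM]; split; last by exists M => t; exact: HM.
  exact: (measurableT_comp mPhi (measurable_to_noise (proj1 nU))).
apply: mean_ext => t /=.
rewrite -mean_walk_exp; last first.
  by move=> y; exact: (bounded_measurable_noise (bK y)).
apply: mean_ext => t'; apply: walk_exp_ext => [j y jn _|y _].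
  by apply: env_local => z z1 z2; rewrite ifT // /S; lia.
by apply: Kloc => z zn; rewrite ifF // /S; lia.
Qed.

(** The middle block of [g] steps is skipped by means of [walk_exp_gap]; the first and
    the last block then decouple, and each contributes its characteristic function.
    The error term is [th] times the mean distance between the end points of two
    walks started [2g] apart, which is [2g] by translation invariance. *)
Lemma charf_merge r n g m th : (2 * r <= g)%N -> 0 <= th ->
  `|charf r (n + g + m) th| <= `|charf r n th| * `|charf r m th| + 2 * g%:R * th.
Proof.
move=> rg th0.
pose h (y : int) := cos (th * y%:~R).
pose H (w : noise_space R lattice) x := walk_exp (truncated_env r w) m (n + g) h x.
pose I (w : noise_space R lattice) x := walk_exp (truncated_env r w) m (n + g) intr x.
have bH x : bounded_measurable (H^~ x).
  by apply: bounded_measurable_quenched => y; exact: bounded_measurable_cst.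
have bI x : bounded_measurable (I^~ x).
  by apply: bounded_measurable_quenched => y; exact: bounded_measurable_cst.
have loc f w w' x : (forall z : lattice, (n + r)%:Z <= z.2 -> w z = w' z) ->
    walk_exp (truncated_env r w) m (n + g) f x = walk_exp (truncated_env r w') m (n + g) f x.
  move=> ww'; apply: walk_exp_ext => // j y jn _; apply: env_local => z z1 z2.
  by apply: ww'; lia.
pose KH (w : noise_space R lattice) x := H w (x + g%:Z).
pose KI (w : noise_space R lattice) x := th * (I w (x + g%:Z) - I w (x - g%:Z)).
have bKI x : bounded_measurable (KI^~ x).
  rewrite (_ : KI^~ x = fun w => th * (I w (x + g%:Z) + -1 * I w (x - g%:Z))).
    apply: bounded_measurableM; first exact: bounded_measurable_cst.
    apply: bounded_measurableD => //; apply: bounded_measurableM => //.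
    exact: bounded_measurable_cst.
  by apply/funext => w; rewrite /KI mulN1r.
(* Quenched comparison: forget the [g] steps of the gap. *)
have path w : `|walk_exp (truncated_env r w) (n + g + m) 0 h 0 - walk_exp (truncated_env r w) n 0 (KH w) 0|
    <= walk_exp (truncated_env r w) n 0 (KI w) 0.
  rewrite -addnA walk_exp_comp add0n; apply: walk_exp_dist => [|x]; first exact: step_right_prob.
  rewrite walk_exp_comp.
  apply: (@walk_exp_gap _ (truncated_env r w) g m n (n + g) h th) => //; first exact: step_right_prob.
  move=> y; apply: le_trans (cos_lipschitz _ _) _.
  by rewrite -mulrBr -rmorphB /= addrAC subrr add0r normrM (ger0_norm th0) mulrC ger0_norm.
(* The restart at [n + g] is now independent of the first block. *)
have EH : mean P (fun t => walk_exp (truncated_env r (V^~ t)) n 0 (KH (V^~ t)) 0) =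
    charf r m th * (cos (th * g%:R) * charf r n th).
  rewrite annealed_decouple => [|x|w w' x ww']; [|exact: bH|exact: loc].
  rewrite -[g%:R]/((g%:Z)%:~R) -annealed_exp_cos_shift.
  have -> : (fun y => mean P (fun t => KH (V^~ t) y)) =
      (fun y => charf r m th * cos (th * (y + g%:Z)%:~R) + 0 * 0).
    by apply/funext => y; rewrite /KH annealed_exp_shift annealed_exp_cos_shift mul0r addr0 mulrC.
  by rewrite annealed_exp_lin mul0r addr0.
(* By translation invariance the mean displacement does not depend on the start. *)
have EI : mean P (fun t => walk_exp (truncated_env r (V^~ t)) n 0 (KI (V^~ t)) 0) = 2 * g%:R * th.
  rewrite annealed_decouple => [|x|w w' x ww']; [|exact: bKI|by rewrite /KI /I !(loc intr w w')].
  rewrite -[RHS](annealed_exp_cst r n); congr annealed_exp; apply/funext => y.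
  have -> : mean P (fun t => KI (V^~ t) y) =
     mean P (fun t => th * I (V^~ t) (y + g%:Z) + - th * I (V^~ t) (y - g%:Z)).
    by apply: mean_ext => t; rewrite /KI mulrBr mulNr.
  rewrite mean_lin; [|exact: bounded_measurable_walk_noise..].
  rewrite !annealed_exp_shift.
  have E (x : int) : annealed_exp r m (fun z => (z + x)%:~R) = annealed_exp r m intr + x%:~R.
    rewrite -[X in _ = _ + X](annealed_exp_cst r m) -[X in _ = X + _]mul1r -[X in _ = _ + X]mul1r.
    by rewrite -annealed_exp_lin; congr annealed_exp; apply/funext => z; rewrite rmorphD /= !mul1r.
  by rewrite !E !rmorphD rmorphN /=; lra.
have := @mean_normr_le _ _ _ P
  (fun t => walk_exp (truncated_env r (V^~ t)) (n + g + m) 0 h 0 + -1 * walk_exp (truncated_env r (V^~ t)) n 0 (KH (V^~ t)) 0)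
  (fun t => walk_exp (truncated_env r (V^~ t)) n 0 (KI (V^~ t)) 0).
have b1 : bounded_measurable (fun t => walk_exp (truncated_env r (V^~ t)) (n + g + m) 0 h 0).
  exact: bounded_measurable_walk_noise.
have b2 : bounded_measurable (fun t => walk_exp (truncated_env r (V^~ t)) n 0 (KH (V^~ t)) 0).
  apply: (bounded_measurable_noise (Phi := fun w => walk_exp (truncated_env r w) n 0 (KH w) 0)).
  by apply: bounded_measurable_quenched => y; exact: bH.
have b3 : bounded_measurable (fun t => walk_exp (truncated_env r (V^~ t)) n 0 (KI (V^~ t)) 0).
  apply: (bounded_measurable_noise (Phi := fun w => walk_exp (truncated_env r w) n 0 (KI w) 0)).
  by apply: bounded_measurable_quenched => y; exact: bKI.
have b4 : bounded_measurable (fun t => -1 * walk_exp (truncated_env r (V^~ t)) n 0 (KH (V^~ t)) 0).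
  by apply: bounded_measurableM => //; exact: bounded_measurable_cst.
move=> /(_ (bounded_measurableD b1 b4) b3).
rewrite meanD // meanZ // EH EI mulN1r => key.
have {}key := key (fun t => eq_rect _ (fun X => `|_ + X| <= _) (path (V^~ t)) _ (esym (mulN1r _))).
rewrite -[mean P _]/(charf r (n + g + m) th) in key.
have c1 : `|charf r m th * (cos (th * g%:R) * charf r n th)| <= `|charf r n th| * `|charf r m th|.
  rewrite !normrM mulrC; apply: ler_wpM2r => //.
  by rewrite ler_piMl // cos_max.
rewrite -[charf r (n + g + m) th](subrK (charf r m th * (cos (th * g%:R) * charf r n th))).
by apply: le_trans (ler_normD _ _) _; rewrite addrC; apply: lerD.
Qed.

End annealed_walk.
End environment.

(** * Induction on scales *)

Lemma root8 n : (0 < n)%N -> exists2 r, (0 < r)%N & (r ^ 8 <= n < r.+1 ^ 8)%N.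
Proof.
move=> n0.
have ex : exists r, (r ^ 8 <= n)%N by exists 0%N.
have ub r : (r ^ 8 <= n)%N -> (r <= n)%N.
  by apply: leq_trans; case: r => // r; apply: leq_pexp2l (isT : (1 <= 8)%N).
case: (ex_maxnP ex ub) => r rn rmax; exists r.
  by apply: rmax; rewrite exp1n.
rewrite rn ltnNge; apply/negP => /rmax; rewrite ltnn //.
Qed.

Lemma pow_one_sub (R : realType) (u : R) n : 0 <= u <= 1 ->
  (1 - u) ^+ n * (1 + n%:R * u) <= 1.
Proof.
move=> /andP[u0 u1]; elim: n => [|n IH]; first by rewrite expr0 mul1r mul0r addr0.
apply: le_trans IH; rewrite exprSr -mulrA; apply: ler_wpM2l.
  by rewrite exprn_ge0 // subr_ge0.
rewrite -natr1; have : (0 : R) <= n%:R by []. nra.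
Qed.

(** The numerical content of three consecutive merges: squaring three times brings
    3/4 well below 1/2, which leaves room for errors of 1/100. *)
Lemma squaring_bound (R : realFieldType) (a b a1 a2 a3 : R) :
  0 <= a -> 0 <= b -> 0 <= a1 -> 0 <= a2 -> b <= 1 ->
  b ^+ 2 <= 3 / 4 -> a <= b + 1 / 100 -> a1 <= a * a + 1 / 100 ->
  a2 <= a1 * a1 + 1 / 100 -> a3 <= a2 * a2 + 1 / 100 -> a3 <= 1 / 2.
Proof.
move=> a0 b0 a10 a20 b1 bb ab h1 h2 h3.
have A0 : a * a <= 78 / 100.
  have : a * a <= (b + 1 / 100) * (b + 1 / 100) by apply: ler_pM.
  by move: bb b1; rewrite expr2; clear; nra.
have A1 : a1 <= 79 / 100 by clear -h1 A0; lra.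
have A2 : a2 <= 64 / 100.
  have : a1 * a1 <= 79 / 100 * (79 / 100) by apply: ler_pM.
  by clear -h2; lra.
have : a2 * a2 <= 64 / 100 * (64 / 100) by apply: ler_pM.
by clear -h3; lra.
Qed.

Section truncation_parameters.
Variables (R : realType) (K : R).
Hypothesis K_gt0 : 0 < K.

Variable r0 : nat.
Hypothesis r0_large : (1800 <= r0)%N.
Hypothesis r0_K : 400 * (3 * 256 ^+ 2 * K) <= r0%:R.

Let r0_pos : (0 < r0)%N. Proof. exact: leq_trans r0_large. Qed.

(** There are at most [3 n^2] sites, and [n <= 256 r^8] because [r + 1 <= 2 r]; the factor
    [r^-28] of the error leaves [r^-12], which [r0_K] makes small. *)
Lemma truncation_error_small r n : (r0 <= r)%N -> (n < r.+1 ^ 8)%N ->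
  truncation_error K r n <= 1 / 400.
Proof.
move=> r0r nr; rewrite /truncation_error.
have rp : (0 < r)%N := leq_trans r0_pos r0r.
have rR : (0 : R) < r%:R by rewrite ltr0n.
have n256 : (n <= 256 * r ^ 8)%N.
  apply: (leq_trans (ltnW nr)); rewrite -[256%N]/(2 ^ 8)%N -expnMn leq_exp2r //; lia.
have N : ((2 * n).+1 * n <= 3 * (256 * r ^ 8 * (256 * r ^ 8)))%N.
  have : (n * n <= (256 * r ^ 8) * (256 * r ^ 8))%N by apply: leq_mul.
  have : (n <= n * n)%N by case: (n) => // k; rewrite leq_pmulr.
  have -> : ((2 * n).+1 * n = n + 2 * (n * n))%N by rewrite mulSn mulnA.
  set X := (256 * r ^ 8 * _)%N; set Y := (n * n)%N; lia.
have NR : ((2 * n).+1 * n)%:R <= 3 * 256 ^+ 2 * r%:R ^+ 16 :> R.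
  apply: le_trans (_ : _ <= (3 * (256 * r ^ 8 * (256 * r ^ 8)))%:R) _; first by rewrite ler_nat.
  have : (r ^ 8)%:R = r%:R ^+ 8 :> R by rewrite natrX.
  move: (r ^ 8)%N => Z EZ.
  by rewrite !natrM EZ (exprD r%:R 8 8) le_eqVlt; apply/orP; left; apply/eqP; ring.
rewrite ler_pdivrMr ?exprn_gt0 // (exprD _ 16 12).
have r12 : r0%:R <= r%:R ^+ 12 :> R.
  by rewrite -natrX ler_nat; apply: (leq_trans r0r); apply: (leq_pexp2l (m := r) (n1 := 1)).
have : K * ((2 * n).+1 * n)%:R <= K * (3 * 256 ^+ 2 * r%:R ^+ 16) by rewrite ler_pM2l.
have : 0 <= (r%:R : R) ^+ 16 by rewrite exprn_ge0 // ltW.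
move: r0_K; set c := 3 * 256 ^+ 2; set X := r%:R ^+ 16; set Y := r%:R ^+ 12 in r12 *; nra.
Qed.

Lemma root8_ge n : (r0 ^ 8 <= n)%N -> exists2 r, (r0 <= r)%N & (r ^ 8 <= n < r.+1 ^ 8)%N.
Proof.
move=> n0.
have np : (0 < n)%N by apply: leq_trans n0; rewrite expn_gt0 r0_pos.
have [r rp /andP[rn nr]] := root8 np; exists r; last by rewrite rn.
by rewrite -ltnS -(ltn_exp2r _ _ (isT : (0 < 8)%N)); apply: leq_ltn_trans nr.
Qed.

Lemma theta_small r n (th : R) : (0 < r)%N -> (r ^ 8 <= n)%N -> 0 < th -> th ^+ 4 * n%:R <= 1 ->
  th * r%:R ^+ 2 <= 1.
Proof.
move=> rp rn th0 thn.
have t0 : 0 <= th * r%:R ^+ 2 by rewrite mulr_ge0 // ltW.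
rewrite -(@expr_le1 _ 4) // exprMn -exprM.
apply: le_trans thn; apply: ler_wpM2l; first by rewrite exprn_ge0 // ltW.
by rewrite -natrX ler_nat.
Qed.

End truncation_parameters.

Section multiscale.
Variables (R : realType) (q : int * int -> R) (delta : R).
Hypothesis q_sym : forall x1 x2 : int, q (x1, x2) = q (- x1, x2).
Hypothesis delta01 : 0 <= delta <= 1 / 2.

Local Notation lattice := (int * int)%type.

Variable K : R.
Hypothesis K_gt0 : 0 < K.

Context (d : measure_display) (T : measurableType d) (P : probability T R).
Variable V : lattice -> T -> R.
Hypothesis nV : gaussian_noise P V.
Hypothesis stable : truncation_stable q K P V.

Local Notation charf := (charf q delta P V).
Local Notation annealed_exp := (annealed_exp q delta P V).
Local Notation env := (truncated_env q delta).

Let bounded_quenched r n k h x : bounded_measurable (fun t => walk_exp (env r (V^~ t)) n k h x).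
Proof. exact: (bounded_measurable_walk_noise q delta nV). Qed.

Lemma annealed_exp_le r n h h' : (forall y, h y <= h' y) ->
  annealed_exp r n h <= annealed_exp r n h'.
Proof.
move=> hh; apply: mean_le; [exact: bounded_quenched..|].
by move=> t; apply: walk_exp_le => [|j _]; [exact: step_right_prob|exact: hh].
Qed.

Lemma charf_norm_le1 r n th : `|charf r n th| <= 1.
Proof.
rewrite ler_norml -[X in X <= _](annealed_exp_cst q delta P V r n (-1)).
rewrite -[X in _ && (_ <= X)](annealed_exp_cst q delta P V r n 1).
by apply/andP; split; apply: annealed_exp_le => y; rewrite ?cos_geN1 ?cos_le1.
Qed.

(** Linearised form of the inequality between a square mean and a mean square:
    [u^2 >= 2 c u - c^2] with [c] the mean of [u]. *)
Lemma charf_double r n th : 2 * charf r n th ^+ 2 - 1 <= charf r n (2 * th).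
Proof.
set c := charf r n th.
have -> : 2 * c ^+ 2 - 1 = annealed_exp r n (fun y => (4 * c) * cos (th * y%:~R) + 1 * (- 2 * c ^+ 2 - 1)).
  by rewrite annealed_exp_lin // annealed_exp_cst -/(charf r n th) -/c; ring.
apply: annealed_exp_le => y.
have -> : 2 * th * y%:~R = th * y%:~R + th * y%:~R by ring.
rewrite cosD; have := cos2Dsin2 (th * y%:~R); set u := cos _; set v := sin _.
have := sqr_ge0 (u - c); rewrite !expr2; lra.
Qed.

(** Off the two exceptional events both truncated environments have the same signs as
    the full one, hence as each other. *)
Lemma truncation_change r r' n h : (0 < r)%N -> (0 < r')%N ->
  (forall y, `|h y| <= 1) ->
  `|annealed_exp r n h - annealed_exp r' n h| <=
    2 * (truncation_error K r n + truncation_error K r' n).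
Proof.
move=> r0 r'0 h1.
have [B [mB PB HB]] := stable n r0; have [B' [mB' PB' HB']] := stable n r'0.
have bh r1 : bounded_measurable (fun t => walk_exp (env r1 (V^~ t)) n 0 h 0).
  exact: bounded_quenched.
have mBB : measurable (B `|` B') by exact: measurableU.
have bi : bounded_measurable (fun t => 2 * \1_(B `|` B') t : R).
  by apply: bounded_measurableM; [exact: bounded_measurable_cst|exact: bounded_measurable_indic].
have := @mean_normr_le _ _ _ P
  (fun t => walk_exp (env r (V^~ t)) n 0 h 0 + -1 * walk_exp (env r' (V^~ t)) n 0 h 0)
  (fun t => 2 * \1_(B `|` B') t).
have b1 : bounded_measurable (fun t => -1 * walk_exp (env r' (V^~ t)) n 0 h 0).
  by apply: bounded_measurableM; [exact: bounded_measurable_cst|exact: bh].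
move=> /(_ (bounded_measurableD (bh r) b1) bi).
rewrite meanD // meanZ // mulN1r meanZ; last exact: bounded_measurable_indic.
move=> key; apply: (le_trans (key _)) => [t|].
  have [tB|nB] := pselect ((B `|` B') t).
    rewrite indicE mem_set // mulr1 mulN1r; apply: le_trans (ler_normB _ _) _.
    have w1 r1 : `|walk_exp (env r1 (V^~ t)) n 0 h 0| <= 1.
      rewrite ler_norml; apply: walk_exp_bound; first exact: step_right_prob.
      by move=> y; rewrite -ler_norml.
    by have := w1 r; have := w1 r'; lra.
  rewrite indicE memNset // mulr0 mulN1r.
  rewrite (@walk_exp_ext _ (env r (V^~ t)) (env r' (V^~ t)) n 0 h h) ?subrr ?normr0 // => j y jn yn.
  rewrite /truncated_env /step_right -(HB t _ j y) -?(HB' t _ j y) //; rewrite ?subr0 in yn => //.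
  - by move=> ?; apply: nB; right.
  - by move=> ?; apply: nB; left.
apply: ler_wpM2l => //; rewrite -lee_fin mean_indic // EFinD.
by apply: le_trans (measureU2 P mB mB') (leeD PB PB').
Qed.

(** The bound [1 - cos (th y) <= th |y|] is used below [tau], the bound 2 above. *)
Lemma ball_lower r n th tau : 0 <= th -> 0 <= tau ->
  1 - charf r n th <= th * tau + 2 * annealed_exp r n \1_[set y : int | tau <= `|y%:~R| :> R].
Proof.
move=> th0 tau0.
have -> : 1 - charf r n th = annealed_exp r n (fun y => 1 * 1 + -1 * cos (th * y%:~R)).
  by rewrite annealed_exp_lin // annealed_exp_cst mul1r mulN1r.
have -> : th * tau + 2 * annealed_exp r n \1_[set y : int | tau <= `|y%:~R| :> R] =
    annealed_exp r n (fun y => 1 * (th * tau) + 2 * \1_[set y : int | tau <= `|y%:~R| :> R] y).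
  by rewrite annealed_exp_lin // annealed_exp_cst mul1r.
apply: annealed_exp_le => y; rewrite mulr1 mulN1r mul1r indicE.
have [tay|/negP tay] := pselect (tau <= `|y%:~R| :> R).
  by rewrite mem_set //= mulr1; have := cos_geN1 (th * y%:~R); nra.
rewrite memNset ?mulr0 ?addr0; last by move=> /= H; rewrite H in tay.
have := cos_lipschitz 0 (th * y%:~R); rewrite cos0 sub0r normrN normrM (ger0_norm th0).
move=> /(le_trans (ler_norm _)) H; apply: (le_trans H).
by apply: ler_wpM2l => //; rewrite ltW // ltNge.
Qed.

Variable r0 : nat.
Hypothesis r0_large : (1800 <= r0)%N.
Hypothesis r0_K : 400 * (3 * 256 ^+ 2 * K) <= r0%:R.

Let r0_pos : (0 < r0)%N. Proof. exact: leq_trans r0_large. Qed.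

(** The quantity propagated along scales: [X_n] is spread out at distance [1/th], and
    [th^4 n <= 1] expresses that this distance is at least [n^(1/4)].  The truncation
    radius [r] is the integer part of [n^(1/8)]. *)
Definition spread n := exists r th, [/\ (r0 <= r)%N, (r ^ 8 <= n < r.+1 ^ 8)%N,
  0 < th, th ^+ 4 * n%:R <= 1 & `|charf r n th| <= 1 / 2].

(** A time [n] is written as eight blocks of length [m] separated by gaps of length
    [2r] (the middle gap absorbs the remainder of the division), and the frequency is
    half the one available at time [m]. *)
Lemma spread_step n : (16 * r0 ^ 8 < n)%N ->
  (forall m, (r0 ^ 8 <= m < n)%N -> spread m) -> spread n.
Proof.
move=> nlarge IH.
have [|r r0r /andP[rn nr]] := @root8_ge r0 r0_large n; first by clear -nlarge; lia.
have rp : (0 < r)%N := leq_trans r0_pos r0r.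
have rn2 : (100 * r <= n)%N.
  apply: leq_trans rn; rewrite (expnD r 7 1) expn1 leq_mul2r; apply/orP; right.
  by apply: (@leq_trans r); [by apply: leq_trans r0r; apply: leq_trans r0_large|apply: (leq_pexp2l (m := r) (n1 := 1))].
(* Seven gaps of length at least [2r] take up [14r] time steps. *)
pose m := ((n - 14 * r) %/ 8)%N.
have mlo : (8 * m <= n - 14 * r)%N by rewrite /m; clear; lia.
have mhi : (n - 14 * r < 8 * m + 8)%N by rewrite /m; clear; lia.
have m16 : (n <= 16 * m)%N by clear -mlo mhi rn2 rp; lia.
have mn : (m < n)%N by clear -mlo rn2 rp; lia.
have [|r' [th' [r0r' /andP[rm mr] th0' thm' c']]] := IH m.
  by rewrite mn andbT; clear -m16 nlarge; lia.
have r'p : (0 < r')%N := leq_trans r0_pos r0r'.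
have rr' : (r' <= r)%N.
  rewrite -ltnS -(ltn_exp2r _ _ (isT : (0 < 8)%N)); apply: leq_ltn_trans nr.
  exact: leq_trans rm (ltnW mn).
pose th := th' / 2.
have th0 : 0 < th by rewrite divr_gt0.
have thn : th ^+ 4 * n%:R <= 1.
  apply: le_trans thm'; rewrite /th exprMn.
  have : n%:R <= 16 * m%:R :> R by rewrite -natrM ler_nat.
  have : 0 <= th' ^+ 4 by rewrite exprn_ge0 // ltW.
  have -> : (2^-1 : R) ^+ 4 = 1 / 16 by field.
  set X := th' ^+ 4; nra.
have thr := theta_small rp rn th0 thn.
(* Since [th r^2 <= 1], this amounts to [100 (4 r + 14) <= r^2]; hence the value 1800. *)
have gap g : (g <= 2 * r + 7)%N -> 2 * g%:R * th <= 1 / 100.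
  move=> gr; have gR : g%:R <= 2 * r%:R + 7 :> R by rewrite -natrM -natrD ler_nat.
  have rR : 1800 <= r%:R :> R by rewrite ler_nat; exact: leq_trans r0_large r0r.
  have : 400 * r%:R + 1400 <= (r%:R : R) ^+ 2 by rewrite expr2; nra.
  set Y := (r%:R : R) ^+ 2 in thr *; nra.
have mr' : (m < r.+1 ^ 8)%N by exact: leq_ltn_trans (ltnW mn) nr.
have ch := @truncation_change r r' m (fun y => cos (th * y%:~R)) rp r'p (fun y => cos_max _).
have e1 := truncation_error_small K_gt0 r0_large r0_K r0r mr'.
have e2 := truncation_error_small K_gt0 r0_large r0_K r0r' mr.
have dbl := charf_double r' m th.
have E2 : 2 * th = th' by rewrite /th; field.
rewrite E2 in dbl.
exists r, th; split => //; first by rewrite rn.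
(* [n = m2 + g + m2] with [m2 = 4m + 6r], so that [g] lies between [2r] and [2r + 7]. *)
pose m1 := (m + 2 * r + m)%N; pose m2 := (m1 + 2 * r + m1)%N.
pose g := (n - 2 * m2)%N.
have En : n = (m2 + g + m2)%N by rewrite /g /m2 /m1; clear -mlo mhi rn2 rp; lia.
have M1 := charf_merge q_sym delta01 nV m m (leqnn (2 * r)) (ltW th0).
have M2 := charf_merge q_sym delta01 nV m1 m1 (leqnn (2 * r)) (ltW th0).
have g2r : (2 * r <= g)%N by rewrite /g /m2 /m1; clear -mlo mhi rn2 rp; lia.
have g7 : (g <= 2 * r + 7)%N by rewrite /g /m2 /m1; clear -mlo mhi rn2 rp; lia.
have M3 := charf_merge q_sym delta01 nV m2 m2 g2r (ltW th0).
have G1 := gap _ (leq_addr 7 (2 * r)).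
have G3 := gap _ g7.
rewrite -En in M3; rewrite -/m1 in M1; rewrite -/m2 in M2.
move: ch; rewrite -/(charf r m th) -/(charf r' m th).
set a := charf r m th in M1 *; set b := charf r' m th in dbl *.
set a1 := charf r m1 th in M1 M2 *; set a2 := charf r m2 th in M2 M3 *.
set a3 := charf r n th in M3 *.
move=> ch.
apply: (@squaring_bound _ `|a| `|b| `|a1| `|a2|) => //; first exact: charf_norm_le1.
- rewrite real_normK ?num_real //; move: c'; rewrite ler_norml => /andP[_ c'].
  by lra.
- rewrite -[a](subrK b); apply: le_trans (ler_normD _ _) _; rewrite addrC lerD2l.
  by have := lerD e1 e2; lra.
- by apply: le_trans M1 _; rewrite lerD2l.
- by apply: le_trans M2 _; rewrite lerD2l.
- by apply: le_trans M3 _; rewrite lerD2l.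
Qed.

(** For these finitely many times the environment is almost negligible.  The
    frequency [th = (r + 1)^-2] satisfies [th^4 n <= 1], while [n th^2] is still of
    order [r^4], so that [cos^n th] is small. *)
Lemma spread_base n : (r0 ^ 8 <= n <= 16 * r0 ^ 8)%N ->
  delta <= 1 / (128 * (r0 ^ 8)%:R) -> spread n.
Proof.
move=> /andP[nlo nhi] dsmall.
have [r r0r /andP[rn nr]] := root8_ge r0_large nlo.
have rp : (0 < r)%N := leq_trans r0_pos r0r.
pose th : R := 1 / r.+1%:R ^+ 2.
have s0 : (0 : R) < r.+1%:R by rewrite ltr0n.
have th0 : 0 < th by rewrite divr_gt0 // exprn_gt0.
have n0 : (0 : R) < n%:R by rewrite ltr0n; apply: leq_trans rn; rewrite expn_gt0 rp.
exists r, th; split => //; first by rewrite rn.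
  rewrite /th div1r exprVn -exprM mulrC ler_pdivrMr ?exprn_gt0 // mul1r -natrX ler_nat; exact: ltnW.
have th1 : th <= 1.
  by rewrite /th ler_pdivrMr ?exprn_gt0 // mul1r -natrX ler1n expn_gt0.
have key : `|charf r n th - cos th ^+ n| <= 2 * delta * n%:R.
  rewrite ler_norml lerBrDr lerBlDr.
  have b t : - (2 * delta * n%:R) + cos th ^+ n <= walk_exp (env r (V^~ t)) n 0 (fun y => cos (th * y%:~R)) 0
      <= 2 * delta * n%:R + cos th ^+ n.
    have := @walk_exp_cos R (env r (V^~ t)) n 0 th 0 delta (step_right_prob delta01 _) (step_right_dist delta01 _).
    by rewrite mulr0 cos0 mulr1 ler_norml lerBrDr lerBlDr.
  rewrite -[X in X <= _](mean_cst P) -[X in _ && (_ <= X)](mean_cst P).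
  apply/andP; split; apply: mean_le => //; try exact: bounded_quenched; try exact: bounded_measurable_cst.
    by move=> t; have /andP[] := b t.
  by move=> t; have /andP[] := b t.
have small1 : 2 * delta * n%:R <= 1 / 4.
  have nR : n%:R <= 16 * (r0 ^ 8)%:R :> R by rewrite -natrM ler_nat.
  have N0 : (0 : R) < (r0 ^ 8)%:R by rewrite ltr0n expn_gt0 r0_pos.
  move: dsmall; rewrite ler_pdivlMr; last by rewrite mulr_gt0.
  by have /andP[? _] := delta01; nra.
have c0 : 0 <= cos th.
  have := cos_lipschitz 0 th; rewrite cos0 sub0r normrN (ger0_norm (ltW th0)).
  by move=> /(le_trans (ler_norm _)); lra.
have small2 : cos th ^+ n <= 1 / 4.
  have cu := @cos_upper R th; rewrite (ltW th0) th1 in cu; have {}cu := cu isT.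
  pose u : R := th ^+ 2 / 8.
  have u0 : 0 <= u by rewrite divr_ge0 // sqr_ge0.
  have th2 : th ^+ 2 <= 1 by rewrite expr_le1 // ltW.
  have u1 : u <= 1 by rewrite /u; lra.
  have c1 : cos th ^+ n <= (1 - u) ^+ n by apply: lerXn2r; rewrite ?nnegrE ?subr_ge0.
  apply: (le_trans c1).
  have := @pow_one_sub R u n; rewrite u0 u1 => /(_ isT).
  have nu : 3 <= n%:R * u.
    have nr8 : r%:R ^+ 8 <= n%:R :> R by rewrite -natrX ler_nat.
    rewrite /u /th div1r exprVn -exprM.
    rewrite mulrA ler_pdivlMr // ler_pdivlMr ?exprn_gt0 //.
    apply: le_trans nr8; rewrite (exprD _ 4 4).
    have rR : 1800 <= r%:R :> R by rewrite ler_nat; exact: leq_trans r0_large r0r.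
    have s2 : r.+1%:R <= 2 * r%:R :> R by rewrite -natrM ler_nat; clear -rp; lia.
    have s4 : r.+1%:R ^+ (2 * 2) <= (2 * r%:R) ^+ 4 :> R.
      by apply: lerXn2r; rewrite ?nnegrE //; lra.
    rewrite exprMn in s4.
    have p4 : 384 <= (r%:R : R) ^+ 4.
      apply: le_trans (_ : (r%:R : R) ^+ 1 <= _); first by rewrite expr1; lra.
      by apply: ler_weXn2l => //; lra.
    have E16 : (2 : R) ^+ 4 = 16 by rewrite -natrX.
    rewrite E16 in s4.
    set X := (r%:R : R) ^+ 4 in s4 p4 *; set Y := _ ^+ (2 * 2) in s4 *; nra.
  have : 0 <= (1 - u) ^+ n by rewrite exprn_ge0 // subr_ge0.
  set X := (1 - u) ^+ n; nra.
have : 0 <= cos th ^+ n by rewrite exprn_ge0.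
by move: key; rewrite !ler_norml => /andP[? ?] ?; apply/andP; split; lra.
Qed.

Lemma spread_all n : delta <= 1 / (128 * (r0 ^ 8)%:R) -> (r0 ^ 8 <= n)%N -> spread n.
Proof.
move=> ds; elim/ltn_ind: n => n IH n0.
have [nsmall|nlarge] := leqP n (16 * r0 ^ 8); first by apply: spread_base => //; rewrite n0.
by apply: spread_step => // m /andP[m0 mn]; exact: IH.
Qed.

End multiscale.

(** * Conclusion *)

(** In terms of the squared norm, the decay exponent 50 becomes the integer power 25. *)
Lemma decay_norm2 (R : realType) (q : int * int -> R) (c3 beta : R) : 0 < c3 -> 50 <= beta ->
  (forall x, x <> (0, 0) -> q x <= c3 * euclid_norm R x `^ (- beta)) ->
  forall z, z != (0, 0) -> q z <= c3 * norm2 R z ^- 25.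
Proof.
move=> c0 b50 H z z0; apply: le_trans (H z _) _; first exact/eqP.
rewrite ler_pM2l //.
have n1 := norm2_ge1 R z0.
have e1 : 1 <= euclid_norm R z by rewrite /euclid_norm -/(norm2 R z) -[leLHS]sqrtr1 ler_wsqrtr.
have E : euclid_norm R z `^ (- 50) = norm2 R z ^- 25.
  rewrite powRN powR_mulrn ?(le_trans ler01) //.
  by rewrite -[50%N]/(2 * 25)%N exprM sqr_sqrtr // addr_ge0 ?sqr_ge0.
by rewrite -E; apply: ler_powR => //; rewrite lerN2.
Qed.

Lemma iid_gaussian_noise (R : realType) (I : choiceType) (d : measure_display)
  (T : measurableType d) (P : probability T R) (W : I -> {RV P >-> R}) :
  iid_standard_normal W -> gaussian_noise P W.
Proof.
move=> [ind law]; split => [i|s A us mA]; first exact: measurable_funPT.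
rewrite (_ : [set t | _] = \bigcap_(i in [set` s]) (W i @^-1` A i)); last by apply/seteqP; split.
by rewrite (ind s A us mA); apply: eq_bigr => i _; exact: (law i (A i) (mA i)).
Qed.

Lemma step_prob_sign (R : realType) (g : int * int -> R) (delta : R) :
  step_prob (sign_environment g) delta =
  (fun n x y => if y == x + 1 then step_right delta g n x
                else if y == x - 1 then 1 - step_right delta g n x else 0).
Proof.
apply/funext => n; apply/funext => x; apply/funext => y.
rewrite /step_prob /step_right /sign_environment.
suff H (v : R) (u := (0 < v)%R%:R - (v < 0)%R%:R : R) : (0 < u)%R%:R - (u < 0)%R%:R = Num.sg v.
  by rewrite H.
rewrite {}/u; move: v.
move=> v; case: (ltgtP v 0) => [v0|v0|->].
- by rewrite ltr0_sg //= sub0r oppr_gt0 oppr_lt0 ltr01 ltr10 sub0r.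
- by rewrite gtr0_sg //= subr0 ltr01 ltr10 subr0.
- by rewrite sgr0 /= subrr ltxx subrr.
Qed.

Section annealed_law.
Variables (R : realType) (q : int * int -> R) (delta : R).
Context (d d' : measure_display) (T : measurableType d) (T' : measurableType d').
Variables (P : probability T R) (V : int * int -> T -> R).
Variables (Pf : R.-pker T ~> T') (X : nat -> T' -> int).
Let g w := noise_convolution q (V^~ w).
Hypothesis XW : random_walk (fun w => sign_environment (g w)) delta Pf X.

Lemma probability_inhabited : exists t : T, True.
Proof.
apply: contrapT => noT; have := probability_setT P.
rewrite (_ : setT = set0); last by apply/seteqP; split => t // _; case: noT; exists t.
by rewrite measure0 => /eqP; rewrite eq_sym onee_eq0.
Qed.

Let quenched n (A : set int) w := walk_exp (step_right delta (g w)) n 0 \1_A 0.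

(** The quenched law is a polynomial in finitely many signs of the field, but the
    field is a limit of a series; measurability in the environment is obtained from
    that of the kernel. *)
Lemma annealed_mean n (A : set int) :
  bounded_measurable (quenched n A) /\
  annealed P Pf [set t | A (X n t)] = (mean P (quenched n A))%:E.
Proof.
have XW' w : markov_process (Pf w) X 0
  (fun n x y => if y == x + 1 then step_right delta (g w) n x
                else if y == x - 1 then 1 - step_right delta (g w) n x else 0).
  by rewrite -step_prob_sign; exact: XW.
have Pf1 w : Pf w setT = 1%E by exact: prob_kernel.
have law w : Pf w [set t | A (X n t)] = (quenched n A w)%:E.
  exact: (position_law (Pf1 w) (XW' w)).
have [w0 _] := probability_inhabited.
have mA : measurable [set t | A (X n t)] := measurable_position (XW' w0) n A.
have bq : bounded_measurable (quenched n A).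
  split.
    apply/measurable_EFinP; rewrite (_ : EFin \o _ = Pf ^~ [set t | A (X n t)]).
      exact: measurable_kernel.
    by apply/funext => w; rewrite law.
  exists 1 => w; rewrite -lee_fin.
  have q0 : 0 <= quenched n A w by rewrite -lee_fin -law.
  rewrite (ger0_norm q0) -law -(Pf1 w); apply: le_measure; rewrite ?inE //.
split => //; rewrite mean_EFin // /annealed.
by apply: eq_integral => w _; rewrite law.
Qed.

End annealed_law.

Theorem corollary1p5 (R : realType) :
  exists c0 : R, 0 < c0 /\
  forall (q : int * int -> R) (c3 beta : R),
    (forall x, 0 <= q x) ->
    0 < q (0, 0) ->
    (forall x1 x2 : int, q (x1, x2) = q (- x1, x2)) ->
    0 < c3 -> 2 < beta -> c0 + 3 / 2 <= beta ->
    (forall x, x <> (0, 0) -> q x <= c3 * euclid_norm R x `^ (- beta)) ->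
  exists c2 xi : R, [/\ 0 < c2, 0 < xi &
  forall (d d' : measure_display) (T : measurableType d)
    (T' : measurableType d') (P : probability T R)
    (W : int * int -> {RV P >-> R}),
    iid_standard_normal W ->
    let g := fun w : T => noise_convolution q (fun y => W y w) in
    let f := fun w : T => sign_environment (g w) in
  forall (delta : R) (Pf : R.-pker T ~> T') (X : nat -> T' -> int),
    0 <= delta <= 1 / 2 -> delta <= c2 ->
    random_walk f delta Pf X ->
    (0 < ereal_inf
      [set annealed P Pf [set t | n%:R `^ xi <= `|(X n t)%:~R| :> R]%R
        | n in [set n : nat | (1 <= n)%N]])%E].
Proof.
(* With [c0 = 50] the kernel decays at least like the power 50 of the distance. *)
exists 50; split => // q c3 beta q_ge0 q_gt0 q_sym c3_gt0 _ beta_large q_decay0.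
have b50 : 50 <= beta by lra.
have q_decay := decay_norm2 c3_gt0 b50 q_decay0.
have [K K0 HK] := sign_stable_cone q_ge0 q_gt0 c3_gt0 q_decay.
have [r0 r0_large r0_K] : exists2 r0 : nat, (1800 <= r0)%N & 400 * (3 * 256 ^+ 2 * K) <= r0%:R.
  have [N HN] : exists N : nat, 400 * (3 * 256 ^+ 2 * K) <= N%:R.
    by eexists; exact/ltW/truncnS_gt.
  by exists (1800 + N)%N; [exact: leq_addr|apply: le_trans HN _; rewrite ler_nat leq_addl].
have r0_pos : (0 < r0)%N by exact: leq_trans r0_large.
have r8 : (1 : R) <= (r0 ^ 8)%:R by rewrite ler1n expn_gt0 r0_pos.
(* [delta] is tied to the range [r0^8 <= n <= 16 r0^8] of [spread_base]. *)
exists (1 / (128 * (r0 ^ 8)%:R)), (1 / 8); split => //.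
  by rewrite divr_gt0 // mulr_gt0 // (lt_le_trans ltr01 r8).
move=> d d' T T' P W iidW g f delta Pf X delta01 delta_small XW.
have nW := iid_gaussian_noise iidW.
have d4 : delta <= 1 / 4.
  apply: le_trans delta_small _; rewrite ler_pdivrMr; last by rewrite mulr_gt0 // (lt_le_trans ltr01 r8).
  lra.
pose V y := W y : T -> R.
(* The first bound serves large times, the second one times below [r0^8]. *)
pose c : R := Num.min (1 / 10) ((1 / 4) ^+ (r0 ^ 8)).
have c0 : 0 < c by rewrite lt_min divr_gt0 //= exprn_gt0 // divr_gt0.
apply: (@lt_le_trans _ _ c%:E); first by rewrite lte_fin.
apply: le_ereal_inf_tmp => _ [n n1 <-].
pose A := [set y : int | n%:R `^ (1 / 8) <= `|y%:~R| :> R].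
have [bq ->] := @annealed_mean R q delta d d' T T' P V Pf X XW n A.
rewrite lee_fin.
have [nsmall|nlarge] := ltnP n (r0 ^ 8).
  apply: (@le_trans _ _ ((1 / 4) ^+ n)).
    rewrite ge_min; apply/orP; right; apply: ler_wiXn2l; rewrite ?divr_ge0 //; [lra|exact: ltnW].
  rewrite -(mean_cst P ((1 / 4) ^+ n)); apply: mean_le => //; first exact: bounded_measurable_cst.
  move=> w; apply: walk_exp_right.
  - exact: step_right_prob.
  - move=> j y; have := step_right_dist delta01 (noise_convolution q (V^~ w)) j y.
    by rewrite ler_norml => /andP[? _]; lra.
  - by move=> y; rewrite indicE.
  - rewrite add0r indicE mem_set // /A /= ger0_norm //.
    rewrite -[leRHS]powRr1 //; apply: ler_powR; first by rewrite ler1n.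
    lra.
have stable := HK _ _ P V nW.
have [r [th [r0r /andP[rn nr] th0 thn ch]]] :=
  spread_all q_sym delta01 K0 nW stable r0_large r0_K delta_small nlarge.
have rp : (0 < r)%N := leq_trans r0_pos r0r.
have err := truncation_error_small K0 r0_large r0_K r0r nr.
have low := ball_lower q delta01 nW r n (ltW th0) (powR_ge0 n%:R (1 / 8)).
have [B [mB PB HB]] := stable r n rp.
(* Return from the truncated environment to the original one. *)
have cmp : annealed_exp q delta P V r n \1_A - truncation_error K r n <=
    mean P (fun w => walk_exp (step_right delta (noise_convolution q (V^~ w))) n 0 \1_A 0).
  have bw : bounded_measurable (fun t => walk_exp (truncated_env q delta r (V^~ t)) n 0 \1_A 0).
    exact: (bounded_measurable_walk_noise q delta nW).
  have bB : bounded_measurable (\1_B : T -> R) by exact: bounded_measurable_indic.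
  have b1 : bounded_measurable (fun t => -1 * \1_B t : R).
    by apply: bounded_measurableM => //; exact: bounded_measurable_cst.
  apply: (@le_trans _ _ (mean P (fun t => walk_exp (truncated_env q delta r (V^~ t)) n 0 \1_A 0 + -1 * \1_B t))).
    rewrite meanD // meanZ // mulN1r lerD2l lerN2 -lee_fin mean_indic //.
  apply: mean_le => //; first exact: bounded_measurableD.
  move=> t; rewrite indicE; have [tB|nB] := pselect (B t).
    rewrite mem_set // mulr1.
    have w1 (p : nat -> int -> R) : is_prob p -> 0 <= walk_exp p n 0 \1_A 0 <= 1.
      move=> ip; apply: walk_exp_bound => // y; rewrite indicE.
      by case: (_ \in _); rewrite /= ?lexx ?ler01.
    have /andP[_ ?] := w1 _ (step_right_prob delta01 (trunc q r (V^~ t))).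
    have /andP[? _] := w1 _ (step_right_prob delta01 (noise_convolution q (V^~ t))).
    rewrite /truncated_env; lra.
  rewrite memNset // mulr0 addr0 le_eqVlt; apply/orP; left; apply/eqP.
  apply: walk_exp_ext => // j y jn yn; rewrite subr0 in yn.
  by rewrite /truncated_env /step_right (HB t nB j y) //; lia.
apply: le_trans cmp.
have n0 : (0 : R) <= n%:R by [].
have thtau : th * n%:R `^ (1 / 8) <= 1 / 4.
  have t0 : 0 <= th * n%:R `^ (1 / 8) by rewrite mulr_ge0 ?powR_ge0 // ltW.
  (* [(th n^(1/8))^8 = th^8 n <= th^4]. *)
  have th16 : th <= 1 / 16.
    have := theta_small rp rn th0 thn.
    have rR : 1800 <= r%:R :> R by rewrite ler_nat; exact: leq_trans r0_large r0r.
    rewrite expr2; nra.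
  rewrite -(@ler_pXn2r _ 8) ?nnegrE ?divr_ge0 // exprMn.
  have -> : (n%:R `^ (1 / 8)) ^+ 8 = n%:R :> R.
    by rewrite -powR_mulrn ?powR_ge0 // -powRrM mul1r mulVf ?powRr1.
  rewrite (exprD _ 4 4) mulrAC.
  have -> : (1 / 4 : R) ^+ 8 = 1 * (1 / 16) ^+ 4 by field.
  apply: ler_pM => //; first by rewrite mulr_ge0 // exprn_ge0 // ltW.
    by rewrite exprn_ge0 // ltW.
  by apply: lerXn2r; rewrite ?nnegrE ?divr_ge0 // ltW.
rewrite ge_min; apply/orP; left.
move: ch low; rewrite ler_norml => /andP[_ ?]; rewrite -/A; lra.
Qed.
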